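(* Assume $2\le|\mathcal U_{\mathcal E}|\le T$. With $\delta=1/T^2$ and $T_1\ge|\mathcal U_{\mathcal E}|$, the regret of UCB-TSN satisfies $\mathcal R_\nu(T,\pi)=\tilde O\big(\sqrt{|\mathcal U_{\mathcal E}|T}+T_1\big)$.
   Context: Bandit with network interference: arm set $\mathcal K=[K]$, units $\mathcal U=[N]$, horizon $T$, fixed adjacency matrix $\mathbb H$. Choosing a super arm $A\in\mathcal K^{\mathcal U}$ in round $t$ yields for each unit $i$ the reward $r_{i,t}(A)=Y_i(A)+\eta_{i,t}$ with unknown $Y_i(A)\in[0,1]$ and i.i.d. zero-mean 1-sub-Gaussian noise. A fixed exposure mapping $\mathbf S:\mathcal U\times\mathcal K^{\mathcal U}\times\{\mathbb H\}\to\mathcal U_s$ assigns to $A$ the exposure super arm $(\mathbf S(i,A,\mathbb H))_{i}$. With a fixed partition $\mathcal C$ of $[N]$ into clusters, $\mathcal U_{\mathcal C}$ = exposure vectors constant on clusters, $\mathcal U_{\mathcal O}$ = exposure vectors realized by some $A$, $\mathcal U_{\mathcal E}=\mathcal U_{\mathcal C}\cap\mathcal U_{\mathcal O}$. For $S\in\mathcal U_{\mathcal E}$, $\tilde Y_i(S)=\sum_AY_i(A)\mathbb P(A\mid S)$ with $\mathbb P(\cdot\mid S)$ uniform over super arms whose exposure super arm is $S$; the exposure reward $\tilde r_{i,t}(S)$ is the reward $r_{i,t}(A)$ of such a uniformly drawn $A$. Regret of a policy $\pi$ choosing $S_t\in\mathcal U_{\mathcal E}$: $\mathcal R_\nu(T,\pi)=\frac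 TN\sum_i\tilde Y_i(S^* )-\frac1N\mathbb E_\pi[\sum_{t\le T}\sum_i\tilde r_{i,t}(S_t)]$, $S^*\in\arg\max_{S\in\mathcal U_{\mathcal E}}\sum_i\tilde Y_i(S)$; $\nu$ denotes the instance (reward distributions). Algorithm UCB-TSN (parameters $T_1\le T$, $\delta$): Sampling$(S)$ draws $A$ uniformly among super arms with exposure super arm $S$, pulls it and records $\tilde r_{i,t}(S)=r_{i,t}(A)$. Let $\mathcal N^t_S$ be the number of rounds $t'\le t$ with $S_{t'}=S$ and $\hat R_t(S)$ the average of $\frac1N\sum_i\tilde r_{i,t'}(S_{t'})$ over those rounds. Phase 1 ($t\le T_1$): play the elements of $\mathcal U_{\mathcal E}$ in round-robin order via Sampling (and output ATE estimates $\hat R_{T_1}(S_i)-\hat R_{T_1}(S_j)$). Phase 2 ($T_1<t\le T$): play $S_t=\arg\max_S\big(\hat R_{t-1}(S)+\sqrt{9\log(1/\delta)/\mathcal N^{t-1}_S}\big)$ via Sampling. $\tilde O$ hides polylogarithmic factors; orders are in $K,T$. *)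

(* Defs.v *)
From HB Require Import structures.
From mathcomp Require Import all_boot all_order all_algebra.
From mathcomp Require Import all_classical all_reals all_analysis.
Set Implicit Arguments.
Unset Strict Implicit.
Unset Printing Implicit Defensive.
Import Order.TTheory GRing.Theory Num.Theory.
Local Open Scope ring_scope.

(* Super arms: assignments of an arm in [K] = 'I_K to every unit in [N] = 'I_N. *)
Definition superarm (K N : nat) := {ffun 'I_N -> 'I_K}.
Definition expv (N : nat) (Us : finType) := {ffun 'I_N -> Us}.

Section Model.
Variables (R : realType) (K N : nat) (Us : finType) (H : 'M[bool]_N).
Variable (Sx : 'I_N -> superarm K N -> 'M[bool]_N -> Us).
(* partition of the units into clusters *)
Variable (Cl : {set {set 'I_N}}).

Definition expo (A : superarm K N) : expv N Us := [ffun i => Sx i A H].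

Definition UC : {set expv N Us} :=
  [set v : expv N Us | [forall B in Cl, forall i in B, forall j in B, v i == v j]].
Definition UO : {set expv N Us} := [set v : expv N Us | [exists A : superarm K N, expo A == v]].
Definition UE : {set expv N Us} := UC :&: UO.

Definition pre (v : expv N Us) : {set superarm K N} := [set A | expo A == v].

(* tilde Y_i(S) = sum_A Y_i(A) P(A | S), P(.|S) uniform on pre S *)
Definition Ytil (Y : 'I_N -> superarm K N -> R) (i : 'I_N) (v : expv N Us) : R :=
  \sum_(A in pre v) Y i A * (#|pre v|%:R)^-1.

(* Sampling(S): draw A uniformly in pre S using a Uniform[0,1] variate x
   (index floor(x * |pre S|) in the enumeration of pre S). *)
Definition draw (v : expv N Us) (x : R) : option (superarm K N) :=
  nth None [seq Some A | A <- enum (pre v)] (Num.truncn (x * #|pre v|%:R)).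

Variables (Y : 'I_N -> superarm K N -> R)
          (d : measure_display) (Omega : measurableType d)
          (eta : nat -> 'I_N -> Omega -> R)
          (unif : nat -> Omega -> R).

Definition rtil (t : nat) (v : expv N Us) (i : 'I_N) (w : Omega) : R :=
  match draw v (unif t w) with
  | Some A => Y i A + eta t i w
  | None => 0
  end.

Definition ravg (t : nat) (v : expv N Us) (w : Omega) : R :=
  (N%:R)^-1 * \sum_(i < N) rtil t v i w.

(* histories: list of (played exposure super arm, observed average reward) *)
Definition cnt (h : seq (expv N Us * R)) (v : expv N Us) : nat :=
  count (fun p => p.1 == v) h.
Definition Rhat (h : seq (expv N Us * R)) (v : expv N Us) : R :=
  (\sum_(p <- h | p.1 == v) p.2) / (cnt h v)%:R.

Variables (T T1 : nat) (delta : R)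
          (rr : seq (expv N Us))                 (* round-robin order of U_E *)
          (tb : {set expv N Us} -> expv N Us).   (* tie-breaking among maximizers *)

Definition ucb (h : seq (expv N Us * R)) (v : expv N Us) : R :=
  Rhat h v + Num.sqrt (9 * ln (delta^-1) / (cnt h v)%:R).

(* UCB-TSN choice at round t (1-indexed) given the history of rounds < t *)
Definition choose (t : nat) (h : seq (expv N Us * R)) : expv N Us :=
  if (t <= T1)%N then nth (tb UE) rr ((t.-1) %% #|UE|)
  else tb [set v in UE | [forall v' in UE, ucb h v' <= ucb h v]].

Fixpoint hist (w : Omega) (n : nat) : seq (expv N Us * R) :=
  match n with
  | 0 => [::]
  | n'.+1 => let h := hist w n' in
             let v := choose n'.+1 h in
             rcons h (v, ravg n'.+1 v w)
  end.

Definition played (w : Omega) (t : nat) : expv N Us :=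
  choose t (hist w t.-1).

Local Open Scope ereal_scope.
Definition regret (P : probability Omega R) (Sstar : expv N Us) : \bar R :=
  ((T%:R / N%:R) * \sum_(i < N) Ytil Y i Sstar)%:E
  - ((N%:R)^-1)%:E *
    \int[P]_w ((\sum_(1 <= t < T.+1) \sum_(i < N) rtil t (played w t) i w)%R)%:E.
End Model.

Section Noise.
Local Open Scope classical_set_scope.
Local Open Scope ereal_scope.
Variables (R : realType) (d : measure_display) (Omega : measurableType d)
          (P : probability Omega R).

Definition mutually_independent (I : eqType) (X : I -> Omega -> R) : Prop :=
  forall (s : seq I) (B : I -> set R), uniq s ->
    (forall k, measurable (B k)) ->
    P [set w | forall k, k \in s -> B k (X k w)] =
    \big[*%E/1%E]_(k <- s) P (X k @^-1` B k).

Definition zero_mean_subgauss1 (X : Omega -> R) : Prop :=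
  P.-integrable setT (EFin \o X) /\
  \int[P]_w (X w)%:E = 0 /\
  forall l : R, \int[P]_w (expR (l * X w))%:E <= (expR (l ^+ 2 / 2))%:E.

Definition uniform01 (X : Omega -> R) : Prop :=
  forall B : set R, measurable B ->
    P (X @^-1` B) = (@lebesgue_measure R) (B `&` `[0%R, 1%R]).

Definition joint_family (N : nat) (eta : nat -> 'I_N -> Omega -> R)
  (unif : nat -> Omega -> R) (k : nat * option 'I_N) : Omega -> R :=
  match k.2 with Some i => eta k.1 i | None => unif k.1 end.

Definition noise_model (N : nat) (eta : nat -> 'I_N -> Omega -> R)
  (unif : nat -> Omega -> R) : Prop :=
  [/\ (forall t i, measurable_fun setT (eta t i)) /\
        (forall t, measurable_fun setT (unif t)),
      mutually_independent (joint_family eta unif),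
      forall t i, zero_mean_subgauss1 (eta t i),
      forall t i t' i' (B : set R), measurable B ->
        P (eta t i @^-1` B) = P (eta t' i' @^-1` B)
    & forall t, uniform01 (unif t)].
End Noise.

(* Main.v *)
(** The sampled super arm and the noise of a round are independent of the
    history that determines the exposure arm played in that round.  Hence the
    expected reward of round [t] is the expectation of [Ytil] at the arm
    played, and the regret is the expectation of the sum of the gaps.

    For an arm [v] with empirical sum [Z], count [m] and mean [mu], the process
    [exp (l (Z - m mu) - 3/2 l^2 m)] is a supermartingale for every real [l]:
    given the past, the uniform draw contributes at most [exp (l^2)] and the
    averaged noise at most [exp (l^2 / 2)].  With [l] tuned to a value of [m],
    it is at least [T^3] whenever [Z / m] leaves the confidence interval of
    half-width [b = sqrt (18 ln T / m)].  Pathwise, the gap of a round of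
    phase 2 is therefore at most [2 b] plus [T^-3] times the sum of these
    processes over all arms, all values of [m] and both signs of [l]; in
    expectation these last terms sum up to at most 2, and the bonuses are summed
    through [1 / sqrt m <= 3 (sqrt (m + 1) - sqrt m)] and Cauchy-Schwarz. *)

Require Import Defs.
From HB Require Import structures.
From mathcomp Require Import all_boot all_order all_algebra.
From mathcomp Require Import all_classical all_reals all_analysis.
From mathcomp Require Import measurable_realfun ring lra.
Import Order.TTheory GRing.Theory Num.Theory.
Local Open Scope classical_set_scope.
Local Open Scope ring_scope.
Set Implicit Arguments. Unset Strict Implicit. Unset Printing Implicit Defensive.

(** * Independence from the past *)

Section Independence.
Local Open Scope ereal_scope.
Context (R : realType) d (Omega : measurableType d) (P : probability Omega R).
Context (I : eqType) (X : I -> Omega -> R).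
Hypothesis mX : forall k, measurable_fun setT (X k).

(** A pi-system generating the sigma-algebra of the variables [X k] with [k] in [s]. Equipping
    [Omega] itself with that smaller sigma-algebra expresses dependence on the past without a
    product space of trajectories. *)
Definition cylinders (s : seq I) : set (set Omega) :=
  [set A | exists2 B : I -> set R, (forall k, measurable (B k)) &
           A = [set w | forall k, k \in s -> B k (X k w)]].

Local Notation past s := (g_sigma_algebraType (cylinders s)).
Local Notation past_mfun s f := (@measurable_fun _ _ (past s) _ setT f).

Let mpreX k B : measurable B -> measurable (X k @^-1` B).
Proof. by move=> mB; rewrite -[Y in measurable Y]setTI; exact: mX. Qed.

Lemma cylinders_measurable s A : cylinders s A -> measurable A.
Proof.
move=> [B mB ->]; elim: s => [|k s IHs].
  rewrite (_ : [set _ | _] = setT); first exact: measurableT.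
  by apply/seteqP; split.
rewrite (_ : [set _ | _] = (X k @^-1` B k) `&`
    [set w | forall j, j \in s -> B j (X j w)]); last first.
  apply/seteqP; split=> w /=.
    by move=> h; split=> [|j js]; apply: h; rewrite inE ?eqxx ?js ?orbT.
  by move=> [h1 h2] j; rewrite inE => /predU1P[->//|]; apply: h2.
by apply: measurableI => //; exact: mpreX.
Qed.

Lemma past_measurable s (A : set Omega) :
  measurable (A : set (past s)) -> measurable A.
Proof.
apply: smallest_sub; first exact: sigma_algebra_measurable.
exact: cylinders_measurable.
Qed.

Lemma past_sub s s' (A : set Omega) : {subset s <= s'} ->
  measurable (A : set (past s)) -> measurable (A : set (past s')).
Proof.
move=> ss'; apply: smallest_sub; first exact: smallest_sigma_algebra.
move=> {}A [B mB ->]; apply: sub_sigma_algebra.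
exists (fun k => if k \in s then B k else setT) => [k|]; first by case: ifP.
apply/seteqP; split=> w /= h k; first by case: ifP => // ks _; exact: h.
by move=> ks; move: (h k (ss' _ ks)); rewrite ks.
Qed.

Lemma measurable_past_var s k : k \in s ->
  past_mfun s (X k).
Proof.
move=> ks _ B mB; rewrite setTI; apply: sub_sigma_algebra.
exists (fun j => if j == k then B else setT) => [j|]; first by case: ifP.
apply/seteqP; split=> w /= h; first by move=> j; case: eqP => // ->.
by have := h k ks; rewrite eqxx.
Qed.

Lemma past_fun_sub d' (T : measurableType d') s s' (f : Omega -> T) :
  {subset s <= s'} -> past_mfun s f ->
  past_mfun s' f.
Proof.
move=> ss' mf _ B mB; rewrite setTI; apply: past_sub ss' _.
by rewrite -[Y in measurable Y]setTI; exact: mf.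
Qed.

Lemma past_fun_measurable d' (T : measurableType d') s (f : Omega -> T) :
  past_mfun s f ->
  measurable_fun setT f.
Proof.
move=> mf _ B mB; rewrite setTI; apply: (@past_measurable s).
by rewrite -[Y in measurable Y]setTI; exact: mf.
Qed.

Hypothesis indX : mutually_independent P X.

(** The events [A] obeying the product formula form a Dynkin class, and cylinders are stable under
    intersection. On a cylinder the formula follows by comparing mutual independence over [s] with
    that over [k :: s]. *)
Lemma past_indep s k (A : set Omega) (B : set R) : uniq s -> k \notin s ->
  measurable (A : set (past s)) -> measurable B ->
  P (A `&` X k @^-1` B) = P A * P (X k @^-1` B).
Proof.
move=> us ks mA mB; have mC := mpreX k mB.
apply: (@dynkin_induction _ (past s) (cylinders s)
  (fun A => P (A `&` X k @^-1` B) = P A * P (X k @^-1` B)) erefl) mA.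
- move=> _ _ [B1 mB1 ->] [B2 mB2 ->]; exists (fun k => B1 k `&` B2 k).
    by move=> j; exact: measurableI.
  apply/seteqP; split=> w /= h; first by move=> j js; split; apply h.
  by split=> j js; have [] := h j js.
- by rewrite setTI probability_setT mul1e.
- move=> _ [B1 mB1 ->].
  (* Adding the constraint [B] at the fresh index [k] leaves the constraints on [s] unchanged
     because [k] is not in [s]. *)
  pose B2 j := if j == k then B else B1 j.
  have mB2 j : measurable (B2 j) by rewrite /B2; case: ifP.
  have E1 := @indX s B1 us mB1.
  have uks : uniq (k :: s) by rewrite /= ks.
  have := @indX (k :: s) B2 uks mB2.
  rewrite big_cons {2}/B2 eqxx muleC (eq_big_seq (fun j => P (X j @^-1` B1 j))); last first.
    by move=> j js; rewrite /B2; case: eqP js ks => // -> ->.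
  rewrite -E1 => <-; congr (P _); apply/seteqP; split=> w /=.
    move=> [h1 h2] j; rewrite inE /B2; case: eqP => [->//|_ /=]; exact: h1.
  move=> h; split.
    move=> j js; have := h j; rewrite inE js orbT => /(_ isT).
    by rewrite /B2; case: eqP js ks => // -> ->.
  by have := h k; rewrite inE eqxx => /(_ isT); rewrite /B2 eqxx.
- move=> S mS PS; have mS' := past_measurable mS.
  rewrite setIC -setDE measureD//; last by rewrite -ge0_fin_numE//; exact: fin_num_measure.
  rewrite probability_setC// muleBl ?mul1e//; last exact: fin_num_measure.
  by rewrite (setIC _ S); congr (_ - _); exact: PS.
- move=> F mF tF PF.
  rewrite setI_bigcupl measure_bigcup//; last first.
  - exact: trivIset_setIr.
  - by move=> i _; apply: measurableI => //; exact: past_measurable (mF i).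
  rewrite measure_bigcup//; last by move=> i _; exact: past_measurable (mF i).
  rewrite (eq_eseriesr (fun i _ => PF i)) muleC.
  rewrite -[P (X k @^-1` B)]fineK ?fin_num_measure// -nneseriesZl//.
  by apply: eq_eseriesr => i _; rewrite muleC.
Qed.

(** By [past_indep], the joint law of the point of [past s] and of [X k] agrees with the product law
    on rectangles, hence everywhere. Tonelli then factors the integral; nonnegativity makes this
    valid before integrability is known. *)
Lemma past_indep_int s k (U : Omega -> R) (phi : R -> R) :
  uniq s -> k \notin s ->
  past_mfun s U -> (forall w, 0 <= U w)%R ->
  measurable_fun setT phi -> (forall x, 0 <= phi x)%R ->
  \int[P]_w (U w * phi (X k w))%:E = \int[P]_w (U w)%:E * \int[P]_w (phi (X k w))%:E.
Proof.
move=> us ks mU U0 mphi phi0.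
(* The identity is a random variable with values in the coarser space [past s]; its law is [P]
   restricted to the past. *)
have mid : measurable_fun (setT : set Omega) (idfun : Omega -> past s).
  by move=> _ B mB; rewrite setTI; exact: past_measurable mB.
have mj : measurable_fun (setT : set Omega) (fun w => (w : past s, X k w)).
  by apply: measurable_fun_pair => //; exact: mX.
pose I1 : {mfun Omega >-> past s} :=
  HB.pack (idfun : Omega -> past s) (isMeasurableFun.Build _ _ _ _ _ mid).
pose X2 : {mfun Omega >-> R} :=
  HB.pack (X k) (isMeasurableFun.Build _ _ _ _ _ (mX k)).
pose J : {mfun Omega >-> (past s * R)%type} :=
  HB.pack (fun w => (w : past s, X k w)) (isMeasurableFun.Build _ _ _ _ _ mj).
pose f (z : past s * R) := (U z.1 * phi z.2)%:E.
have mf : measurable_fun setT f.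
  apply/measurable_EFinP; apply: measurable_funM.
    exact: (@measurableT_comp _ _ _ _ _ _ (U : past s -> R)).
  exact: measurableT_comp.
have f0 z : 0 <= f z by rewrite lee_fin mulr_ge0.
have PE : forall A, measurable A -> (distribution P I1 \x distribution P X2) A = distribution P J A.
  apply: product_measure_unique => A B mA mB.
  exact: (past_indep us ks mA mB).
transitivity (\int[distribution P J]_z f z).
  by rewrite ge0_integral_pushforward//.
rewrite -(eq_measure_integral _ (fun A mA _ => PE A mA)).
rewrite fubini_tonelli1//.
under eq_integral => x _.
  rewrite /fubini_F /f /=; under eq_integral do rewrite EFinM.
  rewrite ge0_integralZl//;
    [|exact/measurable_EFinP|by move=> ? _; rewrite lee_fin|by rewrite lee_fin].
  over.
rewrite ge0_integralZr//; last 3 first.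
- exact/measurable_EFinP.
- by move=> ? _; rewrite lee_fin.
- by apply: integral_ge0 => ? _; rewrite lee_fin.
by rewrite !ge0_integral_pushforward//; try exact/measurable_EFinP; move=> ? _; rewrite lee_fin.
Qed.
End Independence.

(** * Calculus of finite expectations *)

Section HasMean.
Context (R : realType) d (Omega : measurableType d) (P : probability Omega R).
Implicit Types f g : Omega -> R.

(** Integrability and a real value are kept together, so that linear computations take place in [R]
    rather than in the extended reals. *)
Definition has_mean f (e : R) :=
  P.-integrable setT (EFin \o f) /\ (\int[P]_w (f w)%:E = e%:E)%E.

Lemma has_mean_measurable f e : has_mean f e -> measurable_fun setT f.
Proof. by case=> /measurable_int /measurable_EFinP. Qed.

Lemma eq_has_mean f g e : f =1 g -> has_mean f e -> has_mean g e.
Proof. by move=> /funext ->. Qed.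

Lemma has_mean_unique f e e' : has_mean f e -> has_mean f e' -> e = e'.
Proof. by move=> [_ fe] [_]; rewrite fe => -[]. Qed.

Lemma has_mean_cst (c : R) : has_mean (fun=> c) c.
Proof.
split; first exact: finite_measure_integrable_cst.
transitivity (c%:E * P setT)%E; first exact: integral_cst.
by rewrite probability_setT mule1.
Qed.

Lemma has_meanD f g a b : has_mean f a -> has_mean g b ->
  has_mean (fun w => f w + g w) (a + b).
Proof.
move=> [If fa] [Ig gb]; split; first exact: (integrableD _ If Ig).
by rewrite integralD_EFin// fa gb.
Qed.

Lemma has_meanZ (c : R) f a : has_mean f a -> has_mean (fun w => c * f w) (c * a).
Proof.
move=> [If fa]; split; first exact: (integrableZl _ c If).
by rewrite (integralZl measurableT If) fa.
Qed.

Lemma has_meanZr (c : R) f a : has_mean f a -> has_mean (fun w => f w * c) (a * c).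
Proof. by rewrite mulrC => /(has_meanZ c); apply: eq_has_mean => w; rewrite mulrC. Qed.

Lemma has_meanB f g a b : has_mean f a -> has_mean g b ->
  has_mean (fun w => f w - g w) (a - b).
Proof.
move=> fa /(has_meanZ (-1)); rewrite mulN1r => gb.
by apply: eq_has_mean (has_meanD fa gb) => w; rewrite mulN1r.
Qed.

Lemma has_mean_sum (J : eqType) (s : seq J) (Q : pred J) (F : J -> Omega -> R) (e : J -> R) :
  (forall j, j \in s -> Q j -> has_mean (F j) (e j)) ->
  has_mean (fun w => \sum_(j <- s | Q j) F j w) (\sum_(j <- s | Q j) e j).
Proof.
elim: s => [|j s IHs] h.
  by rewrite big_nil; apply: eq_has_mean (has_mean_cst 0) => w; rewrite big_nil.
have {}IHs : has_mean (fun w => \sum_(j <- s | Q j) F j w) (\sum_(j <- s | Q j) e j).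
  by apply: IHs => i si; apply: h; rewrite inE si orbT.
rewrite big_cons; case: ifP => Qj.
  apply: eq_has_mean (has_meanD (h j (mem_head _ _) Qj) IHs) => w.
  by rewrite big_cons Qj.
by apply: eq_has_mean IHs => w; rewrite big_cons Qj.
Qed.

Lemma le_has_mean f g a b : has_mean f a -> has_mean g b ->
  (forall w, f w <= g w) -> a <= b.
Proof.
move=> [If fa] [Ig gb] fg; rewrite -lee_fin -fa -gb.
by apply: le_integral => // w _; rewrite lee_fin.
Qed.

Lemma has_mean_ge0 f a : has_mean f a -> (forall w, 0 <= f w) -> 0 <= a.
Proof. by move=> fa f0; apply: le_has_mean (has_mean_cst 0) fa f0. Qed.

Lemma has_mean_ge0_bound f (c : R) : measurable_fun setT f -> (forall w, 0 <= f w) ->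
  (\int[P]_w (f w)%:E <= c%:E)%E -> exists2 e, has_mean f e & e <= c.
Proof.
move=> mf f0 fc.
have I0 : (0 <= \int[P]_w (f w)%:E)%E by apply: integral_ge0 => w _; rewrite lee_fin.
have fE : (\int[P]_w (f w)%:E)%E = (fine (\int[P]_w (f w)%:E))%:E.
  by rewrite fineK// ge0_fin_numE// (le_lt_trans fc) ?ltry.
exists (fine (\int[P]_w (f w)%:E)); last by rewrite -lee_fin -fE.
split => //; apply/integrableP; split; first exact/measurable_EFinP.
under eq_integral => w _ do rewrite /= ger0_norm//.
by rewrite fE ltry.
Qed.

Lemma has_mean_bounded f (c : R) : measurable_fun setT f ->
  (forall w, `|f w| <= c) -> exists e, has_mean f e.
Proof.
move=> mf fc.
have If : P.-integrable setT (EFin \o f).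
  apply: measurable_bounded_integrable => //.
    by rewrite (@le_lt_trans _ _ 1%E) ?ltry// probability_le1.
  by exists c; split; [rewrite num_real|move=> x cx w _; apply: le_trans (fc w) (ltW cx)].
exists (fine (\int[P]_w (f w)%:E)%E); split => //.
by rewrite fineK//; exact: integrable_fin_num.
Qed.

(** Splitting into positive and negative parts carries the Tonelli factorization over to a signed
    [phi]. *)
Lemma has_mean_pos f e : has_mean f e -> exists a b,
  [/\ has_mean (fun w => Num.max (f w) 0) a, has_mean (fun w => Num.max (- f w) 0) b & e = a - b].
Proof.
move=> fe; have mf := has_mean_measurable fe.
have key g (g1 : R) : has_mean g g1 -> exists c, has_mean (fun w => Num.max (g w) 0) c.
  move=> gg1; have mg := has_mean_measurable gg1.
  exists (fine (\int[P]_w (Num.max (g w) 0)%:E)%E).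
  have Ig : P.-integrable setT (EFin \o (fun w => Num.max (g w) 0)).
    apply: le_integrable gg1.1 => //.
      by apply/measurable_EFinP/measurable_maxr.
    by move=> w _; rewrite lee_fin /Num.max; case: ifP; rewrite ?normr0.
  by split => //; rewrite fineK//; exact: integrable_fin_num.
have [a fa] := key _ _ fe.
have [b fb] := key _ _ (has_meanZ (-1) fe).
have {}fb : has_mean (fun w => Num.max (- f w) 0) b.
  by apply: eq_has_mean fb => w; rewrite mulN1r.
exists a, b; split => //; apply: has_mean_unique fe _.
apply: eq_has_mean (has_meanB fa fb) => w; rewrite /Num.max oppr_lt0.
by case: (ltgtP (f w) 0) => [_|_|->]; rewrite ?sub0r ?opprK ?subr0.
Qed.

(** A signed [phi] is what allows the noise itself, and not only its exponential, as the factor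
    independent of the past. *)
Lemma has_mean_indep (I : eqType) (X : I -> Omega -> R)
    (mX : forall k, measurable_fun setT (X k)) (indX : mutually_independent P X)
    (s : seq I) k (U : Omega -> R) (phi : R -> R) u p :
  uniq s -> k \notin s ->
  @measurable_fun _ _ (g_sigma_algebraType (cylinders X s)) _ setT U ->
  (forall w, 0 <= U w) -> measurable_fun setT phi ->
  has_mean U u -> has_mean (fun w => phi (X k w)) p ->
  has_mean (fun w => U w * phi (X k w)) (u * p).
Proof.
move=> us ks mU U0 mphi Uu.
have key (psi : R -> R) (q : R) : measurable_fun setT psi -> (forall x, 0 <= psi x) ->
    has_mean (fun w => psi (X k w)) q ->
    has_mean (fun w => U w * psi (X k w)) (u * q).
  move=> mpsi psi0 psiq.
  have E := past_indep_int mX indX us ks mU U0 mpsi psi0.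
  rewrite Uu.2 psiq.2 -EFinM in E.
  have [|||v hv _] := @has_mean_ge0_bound (fun w => U w * psi (X k w)) (u * q).
  - apply: measurable_funM; first exact: has_mean_measurable Uu.
    exact: has_mean_measurable psiq.
  - by move=> w; rewrite mulr_ge0.
  - by rewrite E.
  by split; [exact: hv.1|rewrite E].
move=> /has_mean_pos [a [b [fa fb ->]]].
have ha := key (fun x => Num.max (phi x) 0) a.
have hb := key (fun x => Num.max (- phi x) 0) b.
rewrite mulrBr; apply: (@eq_has_mean (fun w =>
  U w * Num.max (phi (X k w)) 0 - U w * Num.max (- phi (X k w)) 0)).
  move=> w; rewrite -mulrBr; congr (_ * _); rewrite /Num.max oppr_lt0.
  by case: (ltgtP (phi (X k w)) 0) => [_|_|->]; rewrite ?sub0r ?opprK ?subr0.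
apply: has_meanB.
  apply: ha => // [|x]; first exact: measurable_maxr.
  by rewrite le_max lexx orbT.
apply: hb => // [|x]; last by rewrite le_max lexx orbT.
by apply: measurable_maxr => //; exact: measurable_funN.
Qed.
End HasMean.

(** * Real inequalities *)

Section RealInequalities.
Context (R : realType).
Implicit Types x l z : R.

(** With [a = x / 2], the inequality [1 - a <= expR (- a)] bounds [expR x] by [(1 - a)^-2], and
    likewise for [- x]. A rational function of [a] is then compared with [1 + x ^+ 2]. *)
Lemma cosh_le_small x : `|x| <= 2^-1 -> (expR x + expR (- x)) / 2 <= expR (x ^+ 2).
Proof.
rewrite ler_norml => /andP[x1 x2].
set a := x / 2.
have xE : x = a + a by rewrite /a; lra.
have ef : expR a * expR (- a) = 1 by rewrite -expRD subrr expR0.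
have e0 := expR_gt0 a; have f0 := expR_gt0 (- a).
have e1 := expR_ge1Dx a; have f1 := expR_ge1Dx (- a).
have a2 : a ^+ 2 <= 16^-1 by nra.
have a0 : 0 <= a ^+ 2 by rewrite sqr_ge0.
have le1 : expR a <= (1 - a)^-1.
  by rewrite -[leRHS]mul1r ler_pdivlMr; [nra|lra].
have le2 : expR (- a) <= (1 + a)^-1.
  by rewrite -[leRHS]mul1r ler_pdivlMr; [nra|lra].
have -> : expR x = expR a ^+ 2 by rewrite xE expRD expr2.
have -> : expR (- x) = expR (- a) ^+ 2 by rewrite xE opprD expRD expr2.
have h1 : expR a ^+ 2 <= (1 - a)^-1 ^+ 2 by rewrite lerXn2r// nnegrE; lra.
have h2 : expR (- a) ^+ 2 <= (1 + a)^-1 ^+ 2 by rewrite lerXn2r// nnegrE; lra.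
apply: le_trans (expR_ge1Dx _).
have -> : x ^+ 2 = 4 * a ^+ 2 by rewrite /a; field.
apply: (@le_trans _ _ (((1 - a)^-1 ^+ 2 + (1 + a)^-1 ^+ 2) / 2)); first by lra.
have -> : ((1 - a)^-1 ^+ 2 + (1 + a)^-1 ^+ 2) / 2 = (1 + a ^+ 2) / (1 - a ^+ 2) ^+ 2.
  by field; rewrite !gt_eqF//=; nra.
rewrite ler_pdivrMr; last by rewrite exprn_gt0//; lra.
set y := a ^+ 2 in a2 a0 *.
(* This product equals [(1 + 4 * y) * (1 - y) ^+ 2 - (1 + y)]; the second factor is positive since
   [y <= 1 / 16]. *)
have : 0 <= y * (1 - 7 * y + 4 * y ^+ 2) by rewrite mulr_ge0//; nra.
lra.
Qed.

(* cosh (2 x) = 2 (cosh x)^2 - 1 <= (cosh x)^4 propagates the bound from a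
   neighbourhood of 0 to all reals. *)
Lemma cosh_le x : (expR x + expR (- x)) / 2 <= expR (x ^+ 2).
Proof.
have key n : forall x, `|x| <= 2 ^+ n / 2 -> (expR x + expR (- x)) / 2 <= expR (x ^+ 2).
  elim: n => [|n IHn] {}x xn; first by apply: cosh_le_small; rewrite expr0 in xn; lra.
  have := IHn (x / 2); rewrite normrM [`|2^-1|]ger0_norm; last by lra.
  rewrite exprS in xn; move=> /(_ ltac:(lra)).
  set a := x / 2 => IHa.
  have xE : x = a + a by rewrite /a; lra.
  have -> : x ^+ 2 = a ^+ 2 + a ^+ 2 + a ^+ 2 + a ^+ 2 by rewrite xE; ring.
  rewrite xE opprD !expRD.
  have ef : expR a * expR (- a) = 1 by rewrite -expRD subrr expR0.
  have e0 := expR_gt0 a; have f0 := expR_gt0 (- a).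
  set c := (expR a + expR (- a)) / 2 in IHa *.
  have -> : (expR a * expR a + expR (- a) * expR (- a)) / 2 = 2 * c ^+ 2 - 1.
    by rewrite /c -[X in _ - X]ef; field.
  have c0 : 0 <= c by rewrite /c; lra.
  have c4 : c ^+ 4 <= expR (a ^+ 2) ^+ 4 by rewrite lerXn2r// nnegrE expR_ge0.
  have : 0 <= (c ^+ 2 - 1) ^+ 2 by rewrite sqr_ge0.
  have -> : expR (a ^+ 2) * expR (a ^+ 2) * expR (a ^+ 2) * expR (a ^+ 2) =
    expR (a ^+ 2) ^+ 4 by ring.
  lra.
(* An integer [n] above the absolute value of [x] is below [2 ^ n], the radius reached at level
   [n.+1]. *)
apply: (key (Num.bound `|x|).+1).
rewrite exprS mulrAC divff// mul1r.
apply: le_trans (ltW (archi_boundP (normr_ge0 x))) _.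
by rewrite -natrX ler_nat ltnW// ltn_expl.
Qed.

(** Convexity on the segment from [- l] to [l]: both endpoints lie above the tangent at [m = l * z],
    and the weighted tangent values average to [expR m]. *)
Lemma expR_convex_sym l z : -1 <= z <= 1 ->
  expR (l * z) <= (1 + z) / 2 * expR l + (1 - z) / 2 * expR (- l).
Proof.
move=> /andP[z1 z2]; set m := l * z.
have h1 : expR m * (1 + (l - m)) <= expR l.
  rewrite -[leRHS](_ : expR m * expR (l - m) = _); last by rewrite -expRD addrC subrK.
  by rewrite ler_wpM2l ?expR_ge0 ?expR_ge1Dx.
have h2 : expR m * (1 + (- l - m)) <= expR (- l).
  rewrite -[leRHS](_ : expR m * expR (- l - m) = _); last by rewrite -expRD addrC subrK.
  by rewrite ler_wpM2l ?expR_ge0 ?expR_ge1Dx.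
have {}h1 : (1 + z) / 2 * (expR m * (1 + (l - m))) <= (1 + z) / 2 * expR l.
  by rewrite ler_wpM2l//; lra.
have {}h2 : (1 - z) / 2 * (expR m * (1 + (- l - m))) <= (1 - z) / 2 * expR (- l).
  by rewrite ler_wpM2l//; lra.
apply: le_trans (lerD h1 h2).
rewrite le_eqVlt; apply/orP; left; apply/eqP.
have : m = l * z by []. move: (expR m) => e; move: m {h1 h2} => m ->; by field.
Qed.

(** Hoeffding's lemma with a cruder constant. Averaging the chord bound removes its linear term, as
    the values are centred, and leaves the hyperbolic cosine of [l]. *)
Lemma hoeffding_uniform (J : finType) (D : {set J}) (z : J -> R) l :
  (0 < #|D|)%N -> (forall j, j \in D -> -1 <= z j <= 1) ->
  \sum_(j in D) z j = 0 ->
  (#|D|%:R)^-1 * \sum_(j in D) expR (l * z j) <= expR (l ^+ 2).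
Proof.
move=> D0 zD z0; apply: le_trans (cosh_le l).
have D0' : 0 < (#|D|%:R : R) by rewrite ltr0n.
rewrite ler_pdivrMl//.
apply: le_trans (ler_sum _ (fun j jD => expR_convex_sym l (zD j jD))) _.
rewrite (eq_bigr (fun j =>
    (expR l + expR (- l)) / 2 + z j * ((expR l - expR (- l)) / 2))); last first.
  by move=> j _; field.
by rewrite big_split /= sumr_const -mulr_suml z0 mul0r addr0 -[_ *+ #|_|]mulr_natl.
Qed.

(** Jensen through the tangent at the mean. It reduces the averaged noise to the noise of one unit
    at a time, without using the variance gain of averaging. *)
Lemma expR_avg (N : nat) (x : 'I_N -> R) : (0 < N)%N ->
  expR (N%:R^-1 * \sum_(i < N) x i) <= N%:R^-1 * \sum_(i < N) expR (x i).
Proof.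
move=> N0; have N0' : 0 < (N%:R : R) by rewrite ltr0n.
set m := N%:R^-1 * _.
have h i : expR m * (1 + (x i - m)) <= expR (x i).
  rewrite -[leRHS](_ : expR m * expR (x i - m) = _); last by rewrite -expRD addrC subrK.
  by rewrite ler_wpM2l ?expR_ge0 ?expR_ge1Dx.
rewrite ler_pdivlMl//.
apply: le_trans (ler_sum _ (fun i _ => h i)).
rewrite -mulr_sumr big_split /= sumrB !sumr_const card_ord.
have -> : \sum_(i < N) x i = m *+ N.
  by rewrite /m -mulr_natl mulrA divff ?mul1r// gt_eqF.
by rewrite subrr addr0 mulrC.
Qed.

(** The difference of roots is the inverse of their sum, and that sum is at most [3 * Num.sqrt m%:R]
    because [m + 1 <= 4 * m]. *)
Lemma inv_sqrt_le (m : nat) : (0 < m)%N ->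
  (Num.sqrt (m%:R : R))^-1 <= 3 * (Num.sqrt m.+1%:R - Num.sqrt m%:R).
Proof.
move=> m0; have m1 : 1 <= (m%:R : R) by rewrite ler1n.
have s0 : 0 < Num.sqrt (m%:R : R) by rewrite sqrtr_gt0; lra.
rewrite -[leLHS]mul1r ler_pdivrMr//.
have e1 : Num.sqrt (m%:R : R) ^+ 2 = m%:R by rewrite sqr_sqrtr.
have e2 : Num.sqrt (m.+1%:R : R) ^+ 2 = m%:R + 1 by rewrite sqr_sqrtr// -natr1.
have := sqrtr_ge0 (m.+1%:R : R).
set p := Num.sqrt m.+1%:R in e2 *; set q := Num.sqrt m%:R in e1 s0 * => p0.
rewrite -e1 in m1 e2.
have q1 : 1 <= q by nra.
have pq : p <= 2 * q by nra.
have pq' : q <= p by nra.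
nra.
Qed.

(** The tangent bound gives [expR (- 2^-1) >= 2^-1], so [expR 2^-1 <= 2]. *)
Lemma ln_ge_half (T : nat) : (2 <= T)%N -> 2^-1 <= ln (T%:R : R).
Proof.
move=> T2; have T2' : 2 <= (T%:R : R) by rewrite (ler_nat _ 2).
rewrite -ler_expR lnK; last by rewrite posrE; lra.
have := expR_ge1Dx (- 2^-1 : R).
have : expR (2^-1 : R) * expR (- 2^-1) = 1 by rewrite -expRD subrr expR0.
by have := expR_gt0 (2^-1 : R); have := expR_gt0 (- 2^-1 : R); nra.
Qed.
End RealInequalities.

(** * The algorithm *)

Section Measurability.
Context (R : realType) (K N : nat) (Us : finType) (H : 'M[bool]_N)
  (Sx : 'I_N -> superarm K N -> 'M[bool]_N -> Us) (Cl : {set {set 'I_N}})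
  (Y : 'I_N -> superarm K N -> R).

(** The numerator of [Rhat]: unlike the quotient, it is updated additively from round to round. *)
Definition hsum (h : seq (expv N Us * R)) v : R := \sum_(p <- h | p.1 == v) p.2.

Lemma cnt_rcons (h : seq (expv N Us * R)) p v :
  cnt (rcons h p) v = (cnt h v + (p.1 == v))%N.
Proof. by rewrite /cnt -cats1 count_cat /= addn0. Qed.

Lemma hsum_rcons (h : seq (expv N Us * R)) p v :
  hsum (rcons h p) v = hsum h v + (p.1 == v)%:R * p.2.
Proof.
rewrite /hsum -cats1 big_cat big_cons big_nil /=.
by case: eqP => _ /=; rewrite ?mulr1n ?mulr0n ?addr0 ?mul1r ?mul0r ?addr0.
Qed.

(** The variate enters only through a truncated index, whose level sets are differences of
    half-lines; countably many of them are united. *)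
Lemma measurable_draw v a : measurable [set x : R | draw H Sx v x = a].
Proof.
set m := #|pre H Sx v|.
have mle (j : nat) : measurable [set x : R | (Num.truncn (x * m%:R) <= j)%N].
  have mf : measurable_fun setT (fun x : R => x * m%:R) by exact: measurable_funM.
  have := measurable_fun_ltr mf (measurable_cst (D := setT) (j.+1%:R : R)).
  move=> /(_ measurableT [set true] I); rewrite setTI.
  congr measurable; apply/seteqP; split=> x /=; rewrite truncn_le_nat //.
have mt (j : nat) : measurable [set x : R | Num.truncn (x * m%:R) = j].
  case: j => [|j].
    by have := mle 0%N; congr measurable; apply/seteqP; split=> x /=; rewrite leqn0 => /eqP.
  have := measurableD (mle j.+1) (mle j); congr measurable.
  apply/seteqP; split=> x /=.
    by move=> [h1 /negP h2]; apply/eqP; rewrite eqn_leq h1 /= ltnNge.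
  by move=> ->; split => //; apply/negP; rewrite -ltnNge.
rewrite (_ : [set x | _] =
    \bigcup_(j in [set j | nth None [seq Some A | A <- enum (pre H Sx v)] j = a])
    [set x : R | Num.truncn (x * m%:R) = j]); last first.
  by apply/seteqP; split=> x /=; [move=> xa; exists (Num.truncn (x * m%:R))|move=> [j /= <- <-]].
exact: bigcup_measurable.
Qed.

Lemma measurable_fin_comp d (T : measurableType d) (F : finType) (G : Type)
    (f : T -> F) (g : F -> G) y :
  (forall x, measurable [set w | f w = x]) -> measurable [set w | g (f w) = y].
Proof.
move=> mf; rewrite (_ : [set _ | _] = \bigcup_(x in [set x | g x = y]) [set w | f w = x]).
  by apply: fin_bigcup_measurable => //; exact: finite_finset.
by apply/seteqP; split=> w /=; [move=> e; exists (f w)|move=> [x /= <- <-]].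
Qed.

Lemma measurable_fin_indic d (T : measurableType d) (F : finType) (f : T -> F) x :
  measurable [set w | f w = x] -> measurable_fun setT (fun w => (f w == x)%:R : R).
Proof.
move=> mf; rewrite (_ : (fun _ => _) = \1_[set w | f w = x]).
  exact: measurable_indic.
apply/funext => w; rewrite indicE; congr (nat_of_bool _)%:R.
by apply/eqP/idP; rewrite inE.
Qed.

Lemma measurable_discrete d (T : measurableType d) (g : nat -> T) : measurable_fun setT g.
Proof. by []. Qed.

Context (T1 : nat) (delta : R) (rr : seq (expv N Us)) (tb : {set expv N Us} -> expv N Us).

(** The choice sees the history only through counts and sums, and [tb] acts on the finitely many
    possible sets of maximizers. The space [T] is arbitrary so that the result applies to the
    sigma-algebra of the past. *)
Lemma measurable_choose d (T : measurableType d) (h : T -> seq (expv N Us * R)) t v :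
  (forall u, measurable_fun setT (fun w => cnt (h w) u)) ->
  (forall u, measurable_fun setT (fun w => hsum (h w) u)) ->
  measurable [set w | Defs.choose H Sx Cl T1 delta rr tb t (h w) = v].
Proof.
move=> mcnt mhsum; rewrite /Defs.choose; case: (t <= T1)%N.
  case: (pselect (nth (tb (UE H Sx Cl)) rr (t.-1 %% #|UE H Sx Cl|) = v)) => h'.
    rewrite (_ : [set _ | _] = setT); first exact: measurableT.
    by apply/seteqP; split.
  rewrite (_ : [set _ | _] = set0); first exact: measurable0.
  by apply/seteqP; split.
have mucb u : measurable_fun setT (fun w => ucb delta (h w) u).
  apply: measurable_funD.
    apply: measurable_funM; first exact: mhsum.
    exact: (measurableT_comp (@measurable_discrete _ R (fun n => n%:R^-1)) (mcnt u)).
  exact: (measurableT_comp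
    (@measurable_discrete _ R (fun n => Num.sqrt (9 * ln delta^-1 / n%:R))) (mcnt u)).
have mle u u' : measurable [set w | ucb delta (h w) u' <= ucb delta (h w) u].
  have := measurable_fun_ler (mucb u') (mucb u).
  by move=> /(_ measurableT [set true] I); rewrite setTI.
pose best w u := [forall u' in UE H Sx Cl, ucb delta (h w) u' <= ucb delta (h w) u].
pose leaders w : {set expv N Us} := [set u in UE H Sx Cl | best w u]%SET.
apply: (@measurable_fin_comp _ T _ _ leaders tb).
move=> A.
have mtrue (u : expv N Us) : measurable [set w | best w u].
  rewrite (_ : [set _ | _] = \bigcap_(u' in [set` UE H Sx Cl])
      [set w | ucb delta (h w) u' <= ucb delta (h w) u]).
    apply: fin_bigcap_measurable; last by move=> *; exact: mle.
    exact: finite_finset.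
  by apply/seteqP; split=> w /=; [move/forall_inP|move=> ?; apply/forall_inP].
(* Equality of finite sets is tested membership by membership, each test being an event. *)
rewrite (_ : [set _ | _] = \bigcap_(u in setT) [set w | (u \in leaders w) = (u \in A)]); last first.
  apply/seteqP; split=> w /=; first by move=> e u _ /=; rewrite e.
  by move=> e; apply/finset.setP => u; exact: e.
apply: fin_bigcap_measurable; first exact: finite_finset.
move=> u _.
case uU : (u \in UE H Sx Cl); last first.
  case: (boolP (u \in A)) => uA.
    rewrite (_ : [set _ | _] = set0); first exact: measurable0.
    by apply/seteqP; split => w //=; rewrite finset.inE uU.
  rewrite (_ : [set _ | _] = setT); first exact: measurableT.
  by apply/seteqP; split => w //=; rewrite finset.inE uU.
case: (boolP (u \in A)) => uA.
  rewrite (_ : [set _ | _] = [set w | best w u])//.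
  by apply/seteqP; split => w //=; rewrite finset.inE uU.
rewrite (_ : [set _ | _] = ~` [set w | best w u]).
  exact: measurableC.
apply/seteqP; split => w //=; rewrite finset.inE uU /=; first by move=> /negbT/negP.
by move=> /negP/negbTE.
Qed.
End Measurability.

(** * Law of the sampled super arm *)

Section SamplingLaw.
Context (R : realType) (K N : nat) (Us : finType) (H : 'M[bool]_N)
  (Sx : 'I_N -> superarm K N -> 'M[bool]_N -> Us).
Context d (Omega : measurableType d) (P : probability Omega R).

Lemma has_mean_event (F : eqType) (f : Omega -> F) (x : F) (p : R) :
  measurable [set w | f w = x] -> (P [set w | f w = x] = p%:E)%E ->
  has_mean P (fun w => (f w == x)%:R) p.
Proof.
move=> mf Pp.
have e w : ((f w == x)%:R = \1_[set w | f w = x] w :> R).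
  by rewrite indicE; congr (nat_of_bool _)%:R; apply/eqP/idP; rewrite inE.
apply: (@eq_has_mean _ _ _ _ (\1_[set w | f w = x])); first by move=> w; rewrite e.
split; first exact: integrable_indic.
by rewrite integral_indic// setIT.
Qed.

Lemma has_mean_dom (f g : Omega -> R) b : measurable_fun setT f ->
  (forall w, 0 <= f w <= g w) -> has_mean P g b -> exists2 e, has_mean P f e & e <= b.
Proof.
move=> mf fg gb; have f0 w : 0 <= f w by have /andP[] := fg w.
apply: has_mean_ge0_bound => //; rewrite -gb.2.
apply: ge0_le_integral => //.
- by move=> w _; rewrite lee_fin.
- exact/measurable_EFinP.
- by apply/measurable_EFinP; exact: has_mean_measurable gb.
- by move=> w _; rewrite lee_fin; have /andP[] := fg w.
Qed.

Lemma draw_Some_pre v (x : R) A : draw H Sx v x = Some A -> A \in pre H Sx v.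
Proof.
rewrite /draw; set j := Num.truncn _ => h.
have jm : (j < size (enum (pre H Sx v)))%N.
  rewrite ltnNge; apply/negP => mj.
  by move: h; rewrite nth_default// size_map.
by move: h; rewrite (nth_map A)// => -[<-]; rewrite -mem_enum mem_nth.
Qed.

Lemma draw_SomeE v (x : R) A : A \in pre H Sx v -> 0 <= x ->
  (draw H Sx v x == Some A) = (Num.truncn (x * #|pre H Sx v|%:R) == index A (enum (pre H Sx v))).
Proof.
move=> Av x0; rewrite /draw; set j := Num.truncn _.
have Ae : A \in enum (pre H Sx v) by rewrite mem_enum.
apply/eqP/eqP => [h|->]; last by rewrite (nth_map A) ?index_mem// nth_index.
have jm : (j < size (enum (pre H Sx v)))%N.
  rewrite ltnNge; apply/negP => mj.
  by move: h; rewrite nth_default// size_map.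
by move: h; rewrite (nth_map A)// => -[<-]; rewrite index_uniq// enum_uniq.
Qed.

Variable V : Omega -> R.
Hypotheses (mV : measurable_fun setT V) (V01 : uniform01 P V).

Lemma has_mean_draw v A : A \in pre H Sx v ->
  has_mean P (fun w => (draw H Sx v (V w) == Some A)%:R) (#|pre H Sx v|%:R)^-1.
Proof.
move=> Av; set m := #|pre H Sx v|.
have m0 : 0 < (m%:R : R) by rewrite ltr0n; apply/card_gt0P; exists A.
have mD := @measurable_draw R _ _ _ H Sx v (Some A).
apply: has_mean_event.
  by rewrite -[X in measurable X]setTI; exact: (mV measurableT mD).
rewrite -[LHS]/(P (V @^-1` [set x | draw H Sx v x = Some A])) V01//.
set j := index A (enum (pre H Sx v)).
have jm : (j < m)%N by rewrite /m cardE index_mem mem_enum.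
(* Within the unit interval, the draw returns [A] exactly where the truncated index is [j]; since
   [j < m], this interval of length [1 / m] does not leave the unit interval. *)
rewrite (_ : _ `&` _ = `[(j%:R / m%:R : R), j.+1%:R / m%:R[%classic); last first.
  apply/seteqP; split=> x /=; rewrite !in_itv /=.
    move=> [/eqP h /andP[x0 x1]]; move: h; rewrite draw_SomeE// truncn_eq; last by rewrite mulr_ge0// ltW.
    by rewrite ler_pdivrMr// ltr_pdivlMr.
  move=> /andP[h1 h2].
  have x0 : 0 <= x by apply: le_trans h1; rewrite divr_ge0// ltW.
  split.
    apply/eqP; rewrite draw_SomeE// truncn_eq; last by rewrite mulr_ge0// ltW.
    by rewrite -ler_pdivrMr// -ltr_pdivlMr// h1 h2.
  rewrite x0/= ltW// (lt_le_trans h2)// ler_pdivrMr// mul1r ler_nat//.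
rewrite lebesgue_measure_itv /= lte_fin ltr_pM2r ?invr_gt0// ltr_nat ltnS leqnn.
by rewrite -EFinD -mulrBl -natr1 addrAC subrr add0r mul1r.
Qed.

Lemma draw_partition v (x : R) :
  \sum_(A in pre H Sx v) (draw H Sx v x == Some A)%:R + (draw H Sx v x == None)%:R = 1 :> R.
Proof.
case E : (draw H Sx v x) => [A|] /=; last first.
  by rewrite big1 ?add0r.
have Av := draw_Some_pre E.
rewrite (bigD1 A)//= eqxx big1 ?addr0// => B /andP[_ BA].
by rewrite (_ : (Some A == Some B) = false)//; apply/eqP => -[/eqP]; rewrite eq_sym (negbTE BA).
Qed.

(** The variate 1 does produce [None], but the super arms of [pre v] already carry the whole
    mass. *)
Lemma has_mean_draw_None v : (0 < #|pre H Sx v|)%N ->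
  has_mean P (fun w => (draw H Sx v (V w) == None)%:R) 0.
Proof.
move=> m0.
have := has_meanB (has_mean_cst P 1) (has_mean_sum (P := P) (s := index_enum _)
  (Q := mem (pre H Sx v)) (fun A _ Av => has_mean_draw Av)).
rewrite sumr_const -[_ *+ #|_|]mulr_natl divff ?pnatr_eq0 ?gtn_eqF// subrr.
by apply: eq_has_mean => w; rewrite -[X in X - _](draw_partition v (V w)) addrAC subrr add0r.
Qed.
End SamplingLaw.

(** * Information of past rounds, mean rewards and the exponential supermartingale *)

Section Bandit.
Context (R : realType) d (Omega : measurableType d) (P : probability Omega R).
Context (K N : nat) (Us : finType) (H : 'M[bool]_N)
  (Sx : 'I_N -> superarm K N -> 'M[bool]_N -> Us) (Cl : {set {set 'I_N}})
  (Y : 'I_N -> superarm K N -> R)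
  (eta : nat -> 'I_N -> Omega -> R) (unif : nat -> Omega -> R)
  (T1 : nat) (delta : R) (rr : seq (expv N Us))
  (tb : {set expv N Us} -> expv N Us).
Hypothesis Y01 : forall i A, 0 <= Y i A <= 1.
Hypothesis noise : noise_model P eta unif.

Local Notation X := (joint_family eta unif).
Local Notation past s := (g_sigma_algebraType (cylinders X s)).
Local Notation UE := (UE H Sx Cl).
Local Notation h w n := (hist H Sx Cl Y eta unif T1 delta rr tb w n).
Local Notation S w t := (played H Sx Cl Y eta unif T1 delta rr tb w t).
Local Notation drw v w t := (draw H Sx v (unif t w)).
Local Notation "[ b ]" := ((nat_of_bool b)%:R : R) (format "[ b ]").

(** As play starts in round 1, [rounds n.+1] indexes the variates and noises up to round [n]
    included, which determine [hist w n] and the arm of round [n.+1]. *)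
Definition rounds n : seq (nat * option 'I_N) :=
  [seq (t, o) | t <- iota 0 n, o <- enum {: option 'I_N}].

Lemma mem_rounds n t o : ((t, o) \in rounds n) = (t < n)%N.
Proof.
apply/allpairsP/idP => [[[t' o'] /= [h1 _ [-> _]]]|tn].
  by move: h1; rewrite mem_iota.
by exists (t, o); rewrite mem_iota/= mem_enum.
Qed.

Lemma rounds_uniq n : uniq (rounds n).
Proof.
apply: allpairs_uniq; [exact: iota_uniq|exact: enum_uniq|].
by move=> [? ?] [? ?] _ _ /= [-> ->].
Qed.

Lemma rounds_sub n : {subset rounds n <= rounds n.+1}.
Proof. by move=> [t o]; rewrite !mem_rounds => /ltnW. Qed.

(** Replaces the case analysis on the draw by a finite sum of indicators, to which independence
    applies term by term. *)
Lemma sum_draw t v w (F : superarm K N -> R) :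
  \sum_(A in pre H Sx v) [drw v w t == Some A] * F A =
  if drw v w t is Some A then F A else 0.
Proof.
case E : (drw v w t) => [A|]; last by rewrite big1// => A _; rewrite mul0r.
rewrite (bigD1 A) ?(draw_Some_pre E)//= eqxx mul1r big1 ?addr0// => B /andP[_ BA].
rewrite (_ : (Some A == Some B) = false) ?mul0r//.
by apply/eqP => -[/eqP]; rewrite eq_sym (negbTE BA).
Qed.

Lemma rtilE t v i w : rtil H Sx Y eta unif t v i w =
  \sum_(A in pre H Sx v) [drw v w t == Some A] * (Y i A + eta t i w).
Proof. by rewrite (sum_draw t v w (fun A => Y i A + eta t i w)). Qed.

Let mX k : measurable_fun setT (X k).
Proof. by case: noise => -[me mu] _ _ _ _; case: k => t [i|]; [exact: me|exact: mu]. Qed.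

Let indX : mutually_independent P X.
Proof. by case: noise. Qed.

Lemma past_draw s t v a : (t, None) \in s ->
  @measurable_fun _ _ (past s) R setT (fun w => [drw v w t == a]).
Proof.
move=> ts; apply: measurable_fin_indic.
have mu : @measurable_fun _ _ (past s) R setT (unif t) := measurable_past_var (X := X) ts.
have := mu measurableT _ (@measurable_draw R _ _ _ H Sx v a).
by rewrite setTI.
Qed.

Lemma past_ravg t v :
  @measurable_fun _ _ (past (rounds t.+1)) R setT (ravg H Sx Y eta unif t v).
Proof.
rewrite /ravg; apply: measurable_funM => //.
apply: measurable_sum => i.
rewrite [F in measurable_fun _ F](_ : _ = fun w =>
    \sum_(A <- enum (pre H Sx v)) [drw v w t == Some A] * (Y i A + eta t i w)); last first.
  by apply/funext => w; rewrite rtilE big_enum.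
apply: measurable_sum => A; apply: measurable_funM.
  by apply: past_draw; rewrite mem_rounds.
apply: measurable_funD => //.
have := @measurable_past_var _ _ _ _ X (rounds t.+1) (t, Some i).
by rewrite mem_rounds; apply.
Qed.

(** Counts and sums suffice to determine the next choice, so they are the quantities carried through
    the induction. *)
Lemma past_hist n :
  (forall v, @measurable_fun _ _ (past (rounds n.+1)) nat setT (fun w => cnt (h w n) v)) /\
  (forall v, @measurable_fun _ _ (past (rounds n.+1)) R setT (fun w => hsum (h w n) v)).
Proof.
elim: n => [|n [IHc IHs]].
  split=> v; first exact: (@measurable_cst _ _ (past (rounds 1)) nat setT 0%N).
  rewrite [F in measurable_fun _ F](_ : _ = fun=> 0).
    exact: (@measurable_cst _ _ (past (rounds 1)) R).
  by apply/funext => w; rewrite /= /hsum big_nil.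
have mS v : measurable ([set w | S w n.+1 = v] : set (past (rounds n.+1))).
  exact: (@measurable_choose _ _ _ _ _ _ _ _ _ _ _ _ (past (rounds n.+1)) (fun w => h w n)).
have sub := @rounds_sub n.+1.
split=> v.
  apply: (past_fun_sub sub).
  rewrite /=; under eq_fun do rewrite cnt_rcons.
  apply: measurable_fun_addn => //.
  have := @measurable_fin_comp _ (past (rounds n.+1)) _ nat
    (fun w => S w n.+1) (fun u => nat_of_bool (u == v)) _ mS.
  move=> hh _ B mB; rewrite setTI.
  rewrite (_ : _ @^-1` B = \bigcup_(k in B) [set w | nat_of_bool (S w n.+1 == v) = k]).
    by apply: bigcup_measurable => k _; exact: hh.
  by apply/seteqP; split=> w /=; [move=> Bw; exists (nat_of_bool (S w n.+1 == v))|move=> [k Bk ->]].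
(* Under the indicator, the reward of the random arm played may be replaced by that of the fixed arm
   [v]. *)
rewrite [F in measurable_fun _ F](_ : _ =
    fun w => hsum (h w n) v + [S w n.+1 == v] * ravg H Sx Y eta unif n.+1 v w); last first.
  apply/funext => w /=; rewrite hsum_rcons /=; congr (_ + _); rewrite /played /=.
  by case: eqP => [->|_]; rewrite ?mul0r.
apply: measurable_funD; first exact: (past_fun_sub sub).
apply: measurable_funM; last exact: past_ravg.
apply: (past_fun_sub sub); exact: measurable_fin_indic.
Qed.

Lemma past_played n v : @measurable_fun _ _ (past (rounds n.+1)) R setT (fun w => [S w n.+1 == v]).
Proof.
have [IHc IHs] := past_hist n.
apply: measurable_fin_indic.
exact: (@measurable_choose _ _ _ _ _ _ _ _ _ _ _ _ (past (rounds n.+1)) (fun w => h w n)).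
Qed.

Lemma has_mean_draw_past n (U : Omega -> R) u v a p :
  @measurable_fun _ _ (past (rounds n.+1)) R setT U -> (forall w, 0 <= U w) ->
  has_mean P U u -> has_mean P (fun w => [drw v w n.+1 == a]) p ->
  has_mean P (fun w => U w * [drw v w n.+1 == a]) (u * p).
Proof.
move=> mU U0 Uu ap.
apply: (has_mean_indep mX indX (s := rounds n.+1) (k := (n.+1, None))
  (phi := fun x => [draw H Sx v x == a])) => //.
- exact: rounds_uniq.
- by rewrite mem_rounds ltnn.
- by apply: measurable_fin_indic; exact: measurable_draw.
Qed.

Lemma has_mean_draw_noise n (U : Omega -> R) u v A i (phi : R -> R) q :
  @measurable_fun _ _ (past (rounds n.+1)) R setT U -> (forall w, 0 <= U w) ->
  has_mean P U u -> A \in pre H Sx v ->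
  measurable_fun setT phi -> has_mean P (fun w => phi (eta n.+1 i w)) q ->
  has_mean P (fun w => U w * [drw v w n.+1 == Some A] * phi (eta n.+1 i w))
    (u * (#|pre H Sx v|%:R)^-1 * q).
Proof.
move=> mU U0 Uu Av mphi phiq.
have [[_ mu] _ _ _ u01] := noise.
have hd := has_mean_draw (mu n.+1) (u01 n.+1) Av.
(* The past is enlarged by the draw of the current round; the noise of unit [i] in that round is
   still independent of it. *)
apply: (has_mean_indep mX indX (s := (n.+1, None) :: rounds n.+1) (k := (n.+1, Some i))) => //.
- by rewrite /= mem_rounds ltnn rounds_uniq.
- by rewrite inE mem_rounds ltnn xpair_eqE andbF.
- apply: measurable_funM; last by apply: past_draw; rewrite mem_head.
  by apply: past_fun_sub mU => k kr; rewrite inE kr orbT.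
- by move=> w; rewrite mulr_ge0.
- exact: has_mean_draw_past.
Qed.

Hypothesis S_UE : forall w t, S w t \in UE.

Lemma sum_played t w (F : expv N Us -> R) : \sum_(v in UE) [S w t == v] * F v = F (S w t).
Proof.
rewrite (bigD1 (S w t)) ?S_UE//= eqxx mul1r big1 ?addr0// => v /andP[_ vS].
by rewrite eq_sym (negbTE vS) mul0r.
Qed.

Lemma has_mean_played n : exists p : expv N Us -> R,
  forall v, has_mean P (fun w => [S w n.+1 == v]) (p v).
Proof.
suff /boolp.choice[p hp] : forall v, exists e, has_mean P (fun w => [S w n.+1 == v]) e by exists p.
move=> v.
apply: (@has_mean_bounded _ _ _ _ _ 1).
  exact: (past_fun_measurable mX (past_played (n := n) v)).
by move=> w; case: eqP; rewrite ?normr1 ?normr0.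
Qed.

(** The common [e] stands for conditioning on the past. Expanding over the arm played and the super
    arm drawn, the draw averages [Y] to [Ytil] and the noise terms have mean 0. *)
Lemma has_mean_rtil n i : exists e,
  has_mean P (fun w => rtil H Sx Y eta unif n.+1 (S w n.+1) i w) e /\
  has_mean P (fun w => Ytil H Sx Y i (S w n.+1)) e.
Proof.
have [p hp] := has_mean_played n.
exists (\sum_(v in UE) p v * Ytil H Sx Y i v); split; last first.
  apply: (@eq_has_mean _ _ _ _ (fun w => \sum_(v in UE) [S w n.+1 == v] * Ytil H Sx Y i v)).
    by move=> w; rewrite (sum_played _ _ (Ytil H Sx Y i)).
  by apply: has_mean_sum => v _ _; exact: has_meanZr.
apply: (@eq_has_mean _ _ _ _ (fun w => \sum_(v in UE) \sum_(A in pre H Sx v)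
    ([S w n.+1 == v] * [drw v w n.+1 == Some A] * Y i A +
     [S w n.+1 == v] * [drw v w n.+1 == Some A] * eta n.+1 i w))).
  move=> w; rewrite -(sum_played _ _ (fun v => rtil H Sx Y eta unif n.+1 v i w)).
  apply: eq_bigr => v _; rewrite rtilE mulr_sumr; apply: eq_bigr => A _.
  by rewrite -mulrDr mulrA.
apply: has_mean_sum => v _ _; rewrite /Ytil mulr_sumr.
apply: has_mean_sum => A _ Av.
have [[_ mu] _ sg _ u01] := noise.
have hd := has_mean_draw (mu n.+1) (u01 n.+1) Av.
have [Ieta [Eeta _]] := sg n.+1 i.
have mS := past_played (n := n) v.
have S0 w : 0 <= [S w n.+1 == v] by [].
have h1 := has_meanZr (Y i A) (has_mean_draw_past mS S0 (hp v) hd).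
have h2 := has_mean_draw_noise (i := i) (phi := idfun) (q := 0) mS S0 (hp v) Av
  (@measurable_id _ _ _) (conj Ieta Eeta).
have := has_meanD h1 h2.
by rewrite mulr0 addr0 -mulrA (mulrC _ (Y i A)).
Qed.

Definition arm_mean v : R := N%:R^-1 * \sum_(i < N) Ytil H Sx Y i v.

Lemma Ytil01 i v : (0 < #|pre H Sx v|)%N -> 0 <= Ytil H Sx Y i v <= 1.
Proof.
move=> v0; have v0' : 0 < (#|pre H Sx v|%:R : R) by rewrite ltr0n.
rewrite /Ytil -mulr_suml; apply/andP; split.
  apply: mulr_ge0; last by rewrite invr_ge0 ltW.
  by apply: sumr_ge0 => A _; have /andP[] := Y01 i A.
rewrite ler_pdivrMr// mul1r -[leRHS](_ : \sum_(A in pre H Sx v) 1 = _).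
  by apply: ler_sum => A _; have /andP[] := Y01 i A.
by rewrite sumr_const.
Qed.

Lemma avg01 (F : 'I_N -> R) : (0 < N)%N -> (forall i, 0 <= F i <= 1) ->
  0 <= N%:R^-1 * \sum_(i < N) F i <= 1.
Proof.
move=> N0 F01; have N0' : 0 < (N%:R : R) by rewrite ltr0n.
apply/andP; split.
  by rewrite mulr_ge0 ?invr_ge0 ?ler0n ?sumr_ge0// => i _; have /andP[] := F01 i.
rewrite ler_pdivrMl// mulr1 -[leRHS](_ : \sum_(i < N) 1 = _).
  by apply: ler_sum => i _; have /andP[] := F01 i.
by rewrite sumr_const card_ord.
Qed.

Lemma UE_pre v : v \in UE -> (0 < #|pre H Sx v|)%N.
Proof.
rewrite finset.inE => /andP[_]; rewrite finset.inE => /existsP[A /eqP Av].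
by apply/card_gt0P; exists A; rewrite finset.inE Av.
Qed.

Lemma arm_mean01 v : (0 < N)%N -> v \in UE -> 0 <= arm_mean v <= 1.
Proof. by move=> N0 /UE_pre v0; apply: avg01 => // i; exact: Ytil01. Qed.

Definition arm_reward (A : superarm K N) : R := N%:R^-1 * \sum_(i < N) Y i A.

(** [arm_mean v] is the uniform average of [arm_reward] over [pre v], so the differences are
    centred, and they lie between -1 and 1. *)
Lemma hoeffding_arm v l : (0 < N)%N -> v \in UE ->
  (#|pre H Sx v|%:R)^-1 * \sum_(A in pre H Sx v) expR (l * (arm_reward A - arm_mean v))
  <= expR (l ^+ 2).
Proof.
move=> N0 vU; have v0 := UE_pre vU.
apply: hoeffding_uniform => //.
  move=> A _; have /andP[a1 a2] := arm_mean01 N0 vU.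
  have /andP[b1 b2] : 0 <= arm_reward A <= 1 by apply: avg01.
  by apply/andP; split; lra.
rewrite sumrB sumr_const /arm_reward -mulr_sumr exchange_big /=.
rewrite /arm_mean -mulrnAr -mulrBr.
apply/eqP; rewrite mulf_eq0; apply/orP; right; rewrite subr_eq0; apply/eqP.
rewrite -sumrMnl; apply: eq_bigr => i _.
by rewrite /Ytil -mulr_suml -[RHS]mulr_natr mulfVK// pnatr_eq0 -lt0n.
Qed.

(* The noise contributes the variance proxy 1 and the uniform draw of a super
   arm the proxy 2, whence the 3 / 2. *)
Definition expmart l v n w : R :=
  expR (l * (hsum (h w n) v - (cnt (h w n) v)%:R * arm_mean v)
        - 3 / 2 * l ^+ 2 * (cnt (h w n) v)%:R).

Lemma past_expmart l v n :
  @measurable_fun _ _ (past (rounds n.+1)) R setT (expmart l v n).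
Proof.
have [mc ms] := past_hist n.
have mcR : @measurable_fun _ _ (past (rounds n.+1)) R setT (fun w => (cnt (h w n) v)%:R).
  exact: (measurableT_comp (@measurable_discrete _ R (fun n => n%:R)) (mc v)).
apply: measurableT_comp; first exact: measurable_expR.
apply: measurable_funB; apply: measurable_funM => //.
by apply: measurable_funB => //; exact: measurable_funM.
Qed.

(** The process is frozen when another arm is played. Writing the update linearly in the indicator
    allows expectations to be taken separately. *)
Lemma expmart_step l v n w : expmart l v n.+1 w =
  expmart l v n w * (1 - [S w n.+1 == v]) +
  expmart l v n w * [S w n.+1 == v] *
    expR (l * (ravg H Sx Y eta unif n.+1 v w - arm_mean v)) * expR (- (3 / 2 * l ^+ 2)).
Proof.
rewrite /expmart /= hsum_rcons cnt_rcons /= -/(S w n.+1) natrD.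
case: eqP => [e|_] /=; last by rewrite !mulr0n mul0r !addr0 mulr0 !mul0r addr0 subr0 mulr1.
rewrite ?e.
rewrite !mulr1n subrr mulr0 add0r mulr1 mul1r -!expRD; congr expR; ring.
Qed.

(** Jensen over the units leaves a single noise variable in each term. The last summand covers the
    draw [None], for which the reward is 0. *)
Lemma ravg_exp_le l v n w : (0 < N)%N ->
  expR (l * (ravg H Sx Y eta unif n v w - arm_mean v)) <=
  N%:R^-1 * \sum_(i < N) \sum_(A in pre H Sx v)
     [drw v w n == Some A] * (expR (l * (arm_reward A - arm_mean v)) * expR (l * eta n i w))
  + [drw v w n == None] * expR (- (l * arm_mean v)).
Proof.
move=> N0; have N0' : (N%:R : R) != 0 by rewrite pnatr_eq0 -lt0n.
under eq_bigr => i _ do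
  rewrite (sum_draw n v w (fun A => expR (l * (arm_reward A - arm_mean v)) * expR (l * eta n i w))).
rewrite /ravg (eq_bigr (fun i => if drw v w n is Some A then Y i A + eta n i w else 0))//.
case: (drw v w n) => [A|] /=; last first.
  by rewrite !big1// !mulr0 !add0r mul1r mulrN.
rewrite mul0r addr0 -mulr_sumr mulrCA.
have -> : l * (N%:R^-1 * \sum_(i < N) (Y i A + eta n i w) - arm_mean v) =
    l * (arm_reward A - arm_mean v) + N%:R^-1 * \sum_(i < N) l * eta n i w.
  by rewrite big_split /= /arm_reward -mulr_sumr; ring.
by rewrite expRD ler_wpM2l ?expR_ge0 ?expR_avg.
Qed.

(** The process starts at 1 and its mean does not increase from one round to the next. *)
Lemma expmart_mean l v n : (0 < N)%N -> v \in UE ->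
  exists2 e, has_mean P (expmart l v n) e & e <= 1.
Proof.
move=> N0 vU; elim: n => [|n [e he e1]].
  exists 1 => //; apply: (@eq_has_mean _ _ _ _ (fun=> 1)); last exact: has_mean_cst.
  by move=> w; rewrite /expmart /= /hsum big_nil mul0r subrr !mulr0 subrr expR0.
have [[_ mu] _ sg _ u01] := noise.
have v0 := UE_pre vU.
have mS := past_played (n := n) v.
have mM := past_expmart (n := n) l v.
pose U w := expmart l v n w * [S w n.+1 == v].
have mU : @measurable_fun _ _ (past (rounds n.+1)) R setT U by exact: measurable_funM.
have M0 w : 0 <= expmart l v n w by exact: expR_ge0.
have U0 w : 0 <= U w by rewrite mulr_ge0.
have UM w : U w <= expmart l v n w by rewrite ler_piMr//; case: eqP.
have [u hu _] : exists2 u, has_mean P U u & u <= e.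
  apply: has_mean_dom he; first exact: (past_fun_measurable mX mU).
  by move=> w; rewrite U0 UM.
have u0 : 0 <= u by exact: has_mean_ge0 hu U0.
have /boolp.choice[q hq] : forall i, exists q,
    has_mean P (fun w => expR (l * eta n.+1 i w)) q /\ q <= expR (l ^+ 2 / 2).
  move=> i; have [_ [_ /(_ l) le]] := sg n.+1 i.
  have [||e' h1 h2] := has_mean_ge0_bound _ _ le; last by exists e'.
    apply: measurableT_comp; first exact: measurable_expR.
    by apply: measurable_funM => //; exact: (mX (n.+1, Some i)).
  by move=> w; exact: expR_ge0.
pose c A := expR (l * (arm_reward A - arm_mean v)).
(* [G] dominates the played part before its variance correction; each summand factors into the past,
   the draw and at most one noise, so its mean [g] is explicit. *)
pose G w := N%:R^-1 * \sum_(i < N) \sum_(A in pre H Sx v)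
     U w * [drw v w n.+1 == Some A] * expR (l * eta n.+1 i w) * c A
  + U w * [drw v w n.+1 == None] * expR (- (l * arm_mean v)).
pose g := N%:R^-1 * \sum_(i < N) \sum_(A in pre H Sx v)
     u * (#|pre H Sx v|%:R)^-1 * q i * c A
  + u * 0 * expR (- (l * arm_mean v)).
have hG : has_mean P G g.
  apply: has_meanD.
    apply: has_meanZ; apply: has_mean_sum => i _ _; apply: has_mean_sum => A _ Av.
    apply: has_meanZr.
    apply: (has_mean_draw_noise (phi := fun x => expR (l * x))) => //; last exact: (hq i).1.
    by apply: measurableT_comp; [exact: measurable_expR|exact: measurable_funM].
  apply: has_meanZr; apply: has_mean_draw_past => //.
  exact: has_mean_draw_None (mu n.+1) (u01 n.+1) _ v0.
(* The factors [expR (l ^+ 2)] of the draw and [expR (l ^+ 2 / 2)] of the noise cancel the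
   correction exactly. *)
have gle : g * expR (- (3 / 2 * l ^+ 2)) <= u.
  rewrite expRN ler_pdivrMr ?expR_gt0// /g mulr0 mul0r addr0.
  have -> : 3 / 2 * l ^+ 2 = l ^+ 2 + l ^+ 2 / 2 by field.
  rewrite expRD ler_pdivrMl ?ltr0n//.
  apply: (@le_trans _ _ (\sum_(i < N) u * (expR (l ^+ 2) * expR (l ^+ 2 / 2)))); last first.
    by rewrite sumr_const card_ord -[_ *+ N]mulr_natl.
  apply: ler_sum => i _.
  have -> : \sum_(A in pre H Sx v) u * (#|pre H Sx v|%:R)^-1 * q i * c A =
     u * (((#|pre H Sx v|%:R)^-1 * \sum_(A in pre H Sx v) c A) * q i).
    by rewrite !mulr_sumr mulr_suml mulr_sumr; apply: eq_bigr => A _; ring.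
  rewrite ler_wpM2l//.
  have q0 : 0 <= q i by apply: has_mean_ge0 (hq i).1 _ => w; exact: expR_ge0.
  apply: ler_pM => //; last exact: (hq i).2; last exact: hoeffding_arm.
  by rewrite mulr_ge0 ?invr_ge0// sumr_ge0// => A _; exact: expR_ge0.
have hB : has_mean P (fun w => (expmart l v n w - U w) + G w * expR (- (3 / 2 * l ^+ 2)))
    ((e - u) + g * expR (- (3 / 2 * l ^+ 2))).
  by apply: has_meanD; [exact: has_meanB|exact: has_meanZr].
have [e' he' e'1] : exists2 e', has_mean P (expmart l v n.+1) e' &
    e' <= (e - u) + g * expR (- (3 / 2 * l ^+ 2)).
  apply: has_mean_dom hB; first exact: (past_fun_measurable mX (past_expmart (n := n.+1) l v)).
  move=> w; rewrite {1}/expmart expR_ge0 expmart_step mulrBr mulr1 /=.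
  rewrite lerD2l ler_wpM2r ?expR_ge0//.
  apply: le_trans (ler_wpM2l (U0 w) (ravg_exp_le l v n.+1 w N0)) _.
  rewrite le_eqVlt; apply/orP; left; apply/eqP.
  rewrite mulrDr /G; congr (_ + _); last by rewrite mulrA.
  rewrite mulrCA; congr (_ * _); rewrite mulr_sumr; apply: eq_bigr => i _.
  by rewrite mulr_sumr; apply: eq_bigr => A _; rewrite /c; ring.
by exists e' => //; lra.
Qed.
End Bandit.

(** * The regret *)

Section MeanBounds.
Context (R : realType) d (Omega : measurableType d) (P : probability Omega R).

Definition mean_le (f : Omega -> R) (c : R) := exists2 e, has_mean P f e & e <= c.

Lemma mean_leD f g a b : mean_le f a -> mean_le g b ->
  mean_le (fun w => f w + g w) (a + b).
Proof.
by move=> [e he ea] [e' he' eb]; exists (e + e'); [exact: has_meanD|exact: lerD].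
Qed.

Lemma mean_leZ c f a : 0 <= c -> mean_le f a -> mean_le (fun w => c * f w) (c * a).
Proof. by move=> c0 [e he ea]; exists (c * e); [exact: has_meanZ|exact: ler_wpM2l]. Qed.

Lemma mean_le_sum (J : eqType) (s : seq J) (Q : pred J) (F : J -> Omega -> R) (c : J -> R) :
  (forall j, j \in s -> Q j -> mean_le (F j) (c j)) ->
  mean_le (fun w => \sum_(j <- s | Q j) F j w) (\sum_(j <- s | Q j) c j).
Proof.
move=> h.
have /boolp.choice[e he] : forall j, exists e, j \in s -> Q j -> has_mean P (F j) e /\ e <= c j.
  move=> j; have [/andP[js Qj]|n] := boolP ((j \in s) && Q j).
    by have [e h1 h2] := h j js Qj; exists e.
  by exists 0 => js Qj; rewrite js Qj in n.
exists (\sum_(j <- s | Q j) e j).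
  by apply: has_mean_sum => j js Qj; have [] := he j js Qj.
rewrite big_seq_cond [leRHS]big_seq_cond; apply: ler_sum => j /andP[js Qj].
by have [] := he j js Qj.
Qed.
End MeanBounds.

(** Cauchy-Schwarz against the constant 1, proved by tangents of the square root. The case
    [k * C = 0] is treated apart because the tangent divides by [s] and [k]. *)
Lemma sum_sqrt_le (R : realType) (J : finType) (D : {set J}) (c : J -> R) :
  (forall j, 0 <= c j) ->
  \sum_(j in D) Num.sqrt (c j) <= Num.sqrt (#|D|%:R * \sum_(j in D) c j).
Proof.
move=> c0; set C := \sum_(j in D) c j; set k : R := #|D|%:R.
have C0 : 0 <= C by apply: sumr_ge0 => j _.
have [kC|kC] := eqVneq (k * C) 0.
  move/eqP: kC; rewrite mulf_eq0 => /orP[k0|/eqP CE].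
    by rewrite big1 ?sqrtr_ge0// => j jD; move: k0; rewrite pnatr_eq0 (cardD1 j) jD.
  rewrite CE mulr0 sqrtr0 big1// => j jD.
  have /eqP := CE; rewrite psumr_eq0// => /allP /(_ j).
  by rewrite mem_index_enum jD => /(_ isT) /eqP ->; rewrite sqrtr0.
have kC0 : 0 < k * C by rewrite lt_def kC mulr_ge0.
have k0 : 0 < k by rewrite lt_def ler0n andbT; apply: contraNneq kC => ->; rewrite mul0r.
set s := Num.sqrt (k * C).
have s0 : 0 < s by rewrite sqrtr_gt0.
have s2 : s ^+ 2 = k * C by rewrite sqr_sqrtr// ltW.
(* Tangent of the square root at the mean [C / k], obtained from a perfect square; summed over [D],
   the right-hand side is exactly [s]. *)
have h j : Num.sqrt (c j) <= c j * (k / s / 2) + s / k / 2.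
  set a := Num.sqrt (c j).
  have -> : c j = a ^+ 2 by rewrite sqr_sqrtr.
  have : 0 <= (a * (k / s) - 1) ^+ 2 * (s / k / 2).
    by rewrite mulr_ge0 ?sqr_ge0// !divr_ge0// ltW.
  have -> : (a * (k / s) - 1) ^+ 2 * (s / k / 2) = a ^+ 2 * (k / s / 2) + s / k / 2 - a.
    by field; rewrite !gt_eqF.
  by rewrite subr_ge0.
apply: le_trans (ler_sum _ (fun j _ => h j)) _.
rewrite big_split /= -mulr_suml -/C sumr_const -[_ *+ #|D|]mulr_natl -/k.
rewrite le_eqVlt; apply/orP; left; apply/eqP.
have -> : C * (k / s / 2) = s / 2.
  transitivity (s ^+ 2 / s / 2); last by field; rewrite gt_eqF.
  by rewrite s2; field; rewrite gt_eqF.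
by field; rewrite gt_eqF.
Qed.

(** * Counts, confidence intervals and the sum of the gaps *)

Section Regret.
Context (R : realType) d (Omega : measurableType d) (P : probability Omega R).
Context (K N : nat) (Us : finType) (H : 'M[bool]_N)
  (Sx : 'I_N -> superarm K N -> 'M[bool]_N -> Us) (Cl : {set {set 'I_N}})
  (Y : 'I_N -> superarm K N -> R)
  (eta : nat -> 'I_N -> Omega -> R) (unif : nat -> Omega -> R)
  (T T1 : nat) (rr : seq (expv N Us)) (tb : {set expv N Us} -> expv N Us)
  (Sstar : expv N Us).

Local Notation UE := (UE H Sx Cl).
Local Notation delta := ((T%:R ^+ 2)^-1 : R).
Local Notation h w n := (hist H Sx Cl Y eta unif T1 delta rr tb w n).
Local Notation S w t := (played H Sx Cl Y eta unif T1 delta rr tb w t).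
Local Notation mu := (arm_mean H Sx Y).
Local Notation M l v n w := (expmart H Sx Cl Y eta unif T1 delta rr tb l v n w).
Local Notation L := (ln (T%:R : R)).

Hypothesis Y01 : forall i A, 0 <= Y i A <= 1.
Hypothesis UET : (2 <= #|UE| <= T)%N.
Hypothesis UET1 : (#|UE| <= T1 <= T)%N.
Hypothesis rrU : perm_eq rr (enum UE).
Hypothesis tbP : forall A : {set expv N Us}, (0 < #|A|)%N -> tb A \in A.
Hypothesis SsU : Sstar \in UE.
Hypothesis Smax : forall v, v \in UE ->
  \sum_(i < N) Ytil H Sx Y i v <= \sum_(i < N) Ytil H Sx Y i Sstar.

(** Without units there is a single exposure vector, against [2 <= #|UE|]. *)
Lemma num_units_gt0 : (0 < N)%N.
Proof.
have /andP[k2 _] := UET; rewrite lt0n; apply/eqP => N0.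
suff : (#|UE| <= 1)%N by rewrite leqNgt k2.
apply/card_le1_eqP => u v _ _; apply/ffunP => i.
by have := ltn_ord i; rewrite {2}N0.
Qed.

Let UE_gt0 : (0 < #|UE|)%N.
Proof. by case/andP: UET => /ltnW. Qed.

Lemma size_rr : size rr = #|UE|.
Proof. by rewrite (perm_size rrU) cardE. Qed.

Lemma choose_ucb t (hh : seq (expv N Us * R)) : (T1 < t)%N ->
  let v := Defs.choose H Sx Cl T1 delta rr tb t hh in
  v \in UE /\ forall u, u \in UE -> ucb delta hh u <= ucb delta hh v.
Proof.
move=> T1t; rewrite /Defs.choose leqNgt T1t /=.
set A := finset _.
have A0 : (0 < #|A|)%N.
  apply/card_gt0P.
  have [v vU vmax] := arg_maxP (ucb delta hh) SsU.
  by exists v; rewrite finset.inE [v \in _]vU; apply/forall_inP => u uU; exact: vmax.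
have := tbP A0; rewrite finset.inE => /andP[-> /forall_inP]; split => //.
Qed.

Lemma played_UE w t : S w t \in UE.
Proof.
rewrite /played; have [tT1|T1t] := leqP t T1; last by have [] := choose_ucb (h w t.-1) T1t.
rewrite /Defs.choose tT1 -mem_enum -(perm_mem rrU) mem_nth//.
by rewrite size_rr ltn_mod.
Qed.

Lemma cnt_histS w n v : cnt (h w n.+1) v = (cnt (h w n) v + (S w n.+1 == v))%N.
Proof. by rewrite /= cnt_rcons. Qed.

Lemma sum_cnt w n : (\sum_(v in UE) cnt (h w n) v)%N = n.
Proof.
elim: n => [|n IHn]; first by rewrite big1.
under eq_bigr do rewrite cnt_histS.
rewrite big_split /= IHn (bigD1 (S w n.+1)) ?played_UE//= eqxx big1 ?addn1//.
by move=> v /andP[_ /negbTE]; rewrite eq_sym => ->.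
Qed.

Lemma cnt_le w n v : v \in UE -> (cnt (h w n) v <= n)%N.
Proof. by move=> vU; rewrite -{2}(sum_cnt w n) (bigD1 v)//= leq_addr. Qed.

(** The arm at position [j] of [rr] is played in round [j + 1], which is at most [#|UE|] and hence
    belongs to phase 1. Bonuses of phase 2 therefore never divide by 0. *)
Lemma cnt_gt0 w n v : (T1 <= n)%N -> v \in UE -> (0 < cnt (h w n) v)%N.
Proof.
move=> T1n vU; have /andP[kT1 _] := UET1.
have vrr : v \in rr by rewrite (perm_mem rrU) mem_enum.
have jk : (index v rr < #|UE|)%N by rewrite -size_rr index_mem.
have mono m : (0 < cnt (h w ((index v rr).+1 + m)%N) v)%N.
  elim: m => [|m IHm]; last by rewrite addnS cnt_histS ltn_addr.
  rewrite addn0 cnt_histS (_ : S w _ = v) ?eqxx ?addn1//.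
  rewrite /played /Defs.choose (leq_trans jk kT1) /= modn_small//.
  by rewrite nth_index.
by rewrite -(subnKC (leq_trans jk (leq_trans kT1 T1n))).
Qed.

Let T2 : (2 <= T)%N.
Proof. by case/andP: UET => k2 /(leq_trans k2). Qed.

Let Lhalf : 2^-1 <= L. Proof. exact: ln_ge_half. Qed.

Definition bonus (m : nat) : R := Num.sqrt (18 * L / m%:R).

Lemma bonus2 m : (0 < m)%N -> bonus m ^+ 2 * m%:R = 18 * L.
Proof.
move=> m0; have m0' : 0 < (m%:R : R) by rewrite ltr0n.
rewrite sqr_sqrtr; first by field; rewrite gt_eqF.
by apply: divr_ge0; [have := Lhalf; lra|exact: ltW].
Qed.

Lemma ucbE (hh : seq (expv N Us * R)) v :
  ucb delta hh v = hsum hh v / (cnt hh v)%:R + bonus (cnt hh v).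
Proof.
rewrite /ucb /Rhat -/(hsum hh v) /bonus; congr (_ + Num.sqrt (_ / _)).
have T0 : 0 < (T%:R : R) by rewrite ltr0n (leq_trans _ T2).
by rewrite invrK lnXn//; ring.
Qed.

Definition tilt m : R := bonus m / 3.

(** [expmart_mean] requires a deterministic tilt, while the count is random: summing over all its
    possible values is a union bound inside the expectation. *)
Definition deviation v n w : R :=
  \sum_(1 <= m < T.+1) (M (tilt m) v n w + M (- tilt m) v n w).

Lemma deviation_ge0 v n w : 0 <= deviation v n w.
Proof. by apply: sumr_ge0 => m _; rewrite addr_ge0 ?expR_ge0. Qed.

(* [tilt m] maximizes [l * x - 3 / 2 * l ^+ 2 * m] at the boundary
   [x = m * bonus m] of the confidence interval; the maximum is [3 * L]. *)
Lemma deviation_large w n v : (0 < cnt (h w n) v <= T)%N ->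
  (cnt (h w n) v)%:R * bonus (cnt (h w n) v) <
    `|hsum (h w n) v - (cnt (h w n) v)%:R * mu v| ->
  T%:R ^+ 3 <= deviation v n w.
Proof.
move=> /andP[]; set m := cnt _ _; set x := hsum _ _ - _ => m0 mT xb.
have b0 : 0 <= bonus m by exact: sqrtr_ge0.
have b2 := bonus2 m0.
have T0 : 0 < (T%:R : R) by rewrite ltr0n (leq_trans _ T2).
(* Here [l] is the tilt with the sign of [x]; the exponent is then at least [6 * L - 3 * L]. *)
have key (l : R) : l * x = tilt m * `|x| -> l ^+ 2 = tilt m ^+ 2 -> T%:R ^+ 3 <= M l v n w.
  move=> lx l2; have -> : T%:R ^+ 3 = expR (3 * L) by rewrite expRM_natl lnK ?posrE.
  rewrite /expmart -/m -/x ler_expR lx l2 /tilt.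
  have : bonus m / 3 * (m%:R * bonus m) <= bonus m / 3 * `|x|.
    by apply: ler_wpM2l; [lra|exact: ltW].
  have -> : bonus m / 3 * (m%:R * bonus m) = 6 * L.
    by transitivity (bonus m ^+ 2 * m%:R / 3); [field|rewrite b2; lra].
  have -> : 3 / 2 * (bonus m / 3) ^+ 2 * m%:R = 3 * L.
    by transitivity (bonus m ^+ 2 * m%:R / 6); [field|rewrite b2; lra].
  lra.
rewrite /deviation (bigD1_seq m) ?mem_index_iota ?m0 ?ltnS ?iota_uniq//=.
apply: (@le_trans _ _ (M (tilt m) v n w + M (- tilt m) v n w)); last first.
  by rewrite lerDl sumr_ge0// => j _; rewrite addr_ge0 ?expR_ge0.
have [x0|x0] := leP 0 x.
  by rewrite (le_trans (key (tilt m) _ _)) ?ger0_norm// lerDl expR_ge0.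
by rewrite (le_trans (key (- tilt m) _ _)) ?sqrrN// ?lerDr ?expR_ge0// ltr0_norm// mulNr mulrN.
Qed.

Lemma gap_bounds v : v \in UE -> 0 <= mu Sstar - mu v <= 1.
Proof.
move=> vU; have N0 := num_units_gt0.
have /andP[a1 a2] := arm_mean01 Y01 N0 SsU; have /andP[b1 b2] := arm_mean01 Y01 N0 vU.
apply/andP; split; last by lra.
by rewrite subr_ge0 ler_wpM2l ?invr_ge0// Smax.
Qed.

(** If all arms stay in their intervals, the mean of [Sstar] is at most its index, hence at most the
    index of the arm played, which exceeds that arm's mean by at most two bonuses. *)
Lemma gap_le w n : (T1 <= n < T)%N ->
  mu Sstar - mu (S w n.+1) <= 2 * bonus (cnt (h w n) (S w n.+1))
     + (T%:R ^+ 3)^-1 * \sum_(u in UE) deviation u n w.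
Proof.
move=> /andP[T1n nT].
have [SU Smx] : S w n.+1 \in UE /\
    forall u, u \in UE -> ucb delta (h w n) u <= ucb delta (h w n) (S w n.+1).
  exact: choose_ucb.
have T0 : 0 < (T%:R ^+ 3 : R) by rewrite exprn_gt0// ltr0n (leq_trans _ T2).
have D0 : 0 <= \sum_(u in UE) deviation u n w.
  by apply: sumr_ge0 => u _; exact: deviation_ge0.
have [/forall_inP good|] := boolP [forall u in UE,
    `|hsum (h w n) u - (cnt (h w n) u)%:R * mu u| <= (cnt (h w n) u)%:R * bonus (cnt (h w n) u)].
  have dev u : u \in UE ->
      `|hsum (h w n) u / (cnt (h w n) u)%:R - mu u| <= bonus (cnt (h w n) u).
    move=> uU; have m0 : 0 < ((cnt (h w n) u)%:R : R) by rewrite ltr0n cnt_gt0.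
    rewrite -(ler_pM2l m0) -{1}(gtr0_norm m0) -normrM mulrBr mulrCA divff ?gt_eqF// mulr1.
    exact: good.
  have := Smx _ SsU; rewrite !ucbE.
  have := dev _ SsU; rewrite ler_norml => /andP[].
  have := dev _ SU; rewrite ler_norml => /andP[].
  have : 0 <= (T%:R ^+ 3)^-1 * \sum_(u in UE) deviation u n w.
    by rewrite mulr_ge0// invr_ge0 ltW.
  lra.
(* Some arm leaves its interval: its deviation is at least [T ^ 3], so the second summand is at
   least 1, which bounds any gap. *)
move=> /forall_inPn[u uU]; rewrite -ltNge => ub.
have /andP[_ g1] := gap_bounds SU.
apply: (le_trans g1); rewrite -[leLHS]add0r; apply: lerD.
  by rewrite mulr_ge0 ?sqrtr_ge0.
rewrite ler_pdivlMl// mulr1.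
apply: (@le_trans _ _ (deviation u n w)).
  by apply: deviation_large => //; rewrite cnt_gt0//= (leq_trans (cnt_le w n uU))// ltnW.
rewrite (bigD1 u)//= lerDl; apply: sumr_ge0 => v _; exact: deviation_ge0.
Qed.

(** The sum of the roots of the counts serves as a potential: playing an arm raises only its own
    root, and by [inv_sqrt_le] this increase pays for the bonus. *)
Lemma sum_bonus w n : (T1 <= n)%N ->
  \sum_(T1 <= j < n) bonus (cnt (h w j) (S w j.+1)) <=
  3 * Num.sqrt (18 * L) * \sum_(u in UE) Num.sqrt (cnt (h w n) u)%:R.
Proof.
elim: n => [|n IHn].
  move=> T10; rewrite big_geq// mulr_ge0 ?mulr_ge0 ?sqrtr_ge0//.
  by apply: sumr_ge0 => u _; exact: sqrtr_ge0.
rewrite leq_eqVlt => /orP[/eqP <-|].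
  rewrite big_geq// mulr_ge0 ?mulr_ge0 ?sqrtr_ge0//.
  by apply: sumr_ge0 => u _; exact: sqrtr_ge0.
rewrite ltnS => T1n; rewrite big_nat_recr//=.
have {IHn} := IHn T1n; set B := \sum_(T1 <= j < n) _ => IHn.
have SU := played_UE w n.+1.
have m0 := cnt_gt0 w T1n SU.
rewrite (bigD1 (S w n.+1)) //= cnt_histS eqxx addn1.
rewrite (bigD1 (S w n.+1)) //= in IHn.
under eq_bigr => u /andP[_ /negbTE uS] do rewrite cnt_histS eq_sym uS addn0.
set B' := \sum_(u in UE | _) _ in IHn *.
have : bonus (cnt (h w n) (S w n.+1)) <= Num.sqrt (18 * L) *
    (3 * (Num.sqrt (cnt (h w n) (S w n.+1)).+1%:R - Num.sqrt (cnt (h w n) (S w n.+1))%:R)).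
  rewrite /bonus sqrtrM ?sqrtrV ?ler0n//; last by have := Lhalf; lra.
  by rewrite ler_wpM2l ?sqrtr_ge0// inv_sqrt_le.
lra.
Qed.

Lemma sum_bonus_le w :
  \sum_(T1 <= j < T) bonus (cnt (h w j) (S w j.+1)) <=
  3 * Num.sqrt (18 * L) * Num.sqrt (#|UE|%:R * T%:R).
Proof.
have /andP[_ T1T] := UET1.
apply: le_trans (sum_bonus w T1T) _.
rewrite ler_wpM2l ?mulr_ge0 ?sqrtr_ge0//.
have sT : \sum_(u in UE) (cnt (h w T) u)%:R = T%:R :> R by rewrite -natr_sum sum_cnt.
have := @sum_sqrt_le R _ UE (fun u => (cnt (h w T) u)%:R) (fun u => ler0n R _).
by rewrite sT.
Qed.

Lemma pathwise_regret w :
  \sum_(0 <= n < T) (mu Sstar - mu (S w n.+1)) <=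
  T1%:R + 6 * Num.sqrt (18 * L) * Num.sqrt (#|UE|%:R * T%:R)
  + (T%:R ^+ 3)^-1 * \sum_(T1 <= n < T) \sum_(u in UE) deviation u n w.
Proof.
have /andP[_ T1T] := UET1.
rewrite (big_cat_nat (leq0n T1) T1T)/= -addrA; apply: lerD.
  rewrite -[leRHS](_ : \sum_(0 <= n < T1) 1 = _); last by rewrite sumr_const_nat subn0.
  by apply: ler_sum => n _; have /andP[] := gap_bounds (played_UE w n.+1).
apply: (@le_trans _ _ (\sum_(T1 <= n < T) (2 * bonus (cnt (h w n) (S w n.+1))
     + (T%:R ^+ 3)^-1 * \sum_(u in UE) deviation u n w))).
  rewrite ler_sum_nat// => n nT; exact: gap_le.
rewrite big_split /= -!mulr_sumr lerD2r.
have := sum_bonus_le w; set B := \sum_(T1 <= n < T) _; lra.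
Qed.

Hypothesis noise : noise_model P eta unif.

Lemma deviation_mean n u : u \in UE -> mean_le P (deviation u n) (2 * T%:R).
Proof.
move=> uU.
have -> : 2 * T%:R = \sum_(1 <= m < T.+1) (1 + 1) :> R.
  by rewrite sumr_const_nat subn1 -[RHS]mulr_natr.
apply: mean_le_sum => m _ _.
by apply: mean_leD; apply: expmart_mean => //; exact: num_units_gt0.
Qed.

(** Round by round, [has_mean_rtil] replaces the observed reward by [Ytil] at the arm played, which
    turns the regret into the mean of a pathwise sum of gaps. *)
Lemma regret_has_mean : exists2 e,
  has_mean P (fun w => \sum_(0 <= n < T) (mu Sstar - mu (S w n.+1))) e &
  regret H Sx Cl Y eta unif T T1 delta rr tb P Sstar = e%:E.
Proof.
have /boolp.choice[e he] : forall ni : nat * 'I_N, exists e,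
    has_mean P (fun w => rtil H Sx Y eta unif ni.1.+1 (S w ni.1.+1) ni.2 w) e /\
    has_mean P (fun w => Ytil H Sx Y ni.2 (S w ni.1.+1)) e.
  by move=> [n i]; apply: has_mean_rtil => //; exact: played_UE.
have hr : has_mean P (fun w => \sum_(1 <= t < T.+1) \sum_(i < N) rtil H Sx Y eta unif t (S w t) i w)
    (\sum_(0 <= n < T) \sum_(i < N) e (n, i)).
  apply: (@eq_has_mean _ _ _ _ (fun w => \sum_(0 <= n < T) \sum_(i < N)
      rtil H Sx Y eta unif n.+1 (S w n.+1) i w)).
    by move=> w; rewrite big_add1.
  apply: has_mean_sum => n _ _; apply: has_mean_sum => i _ _.
  exact: (he (n, i)).1.
have hY : has_mean P (fun w => \sum_(0 <= n < T) \sum_(i < N) Ytil H Sx Y i (S w n.+1))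
    (\sum_(0 <= n < T) \sum_(i < N) e (n, i)).
  by apply: has_mean_sum => n _ _; apply: has_mean_sum => i _ _; exact: (he (n, i)).2.
set E := \sum_(0 <= n < T) _ in hr hY.
exists (T%:R * mu Sstar - N%:R^-1 * E); last first.
  rewrite /regret hr.2 -EFinM -EFinB /arm_mean; congr ((_ - _)%:E).
  by rewrite mulrA.
apply: (@eq_has_mean _ _ _ _ (fun w => T%:R * mu Sstar -
    N%:R^-1 * \sum_(0 <= n < T) \sum_(i < N) Ytil H Sx Y i (S w n.+1))).
  move=> w; rewrite sumrB sumr_const_nat subn0 mulr_natl; congr (_ - _).
  by rewrite mulr_sumr.
by apply: has_meanB; [exact: has_mean_cst|exact: has_meanZ].
Qed.

Lemma regret_le : (regret H Sx Cl Y eta unif T T1 delta rr tb P Sstar <=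
  (T1%:R + 6 * Num.sqrt (18 * L) * Num.sqrt (#|UE|%:R * T%:R) + 2)%:E)%E.
Proof.
have [e he ->] := regret_has_mean; rewrite lee_fin.
have T0 : 0 < (T%:R : R) by rewrite ltr0n (leq_trans _ T2).
set A := T1%:R + _.
have [b hb b2] : mean_le P (fun w => A + (T%:R ^+ 3)^-1 *
    \sum_(T1 <= n < T) \sum_(u in UE) deviation u n w)
    (A + (T%:R ^+ 3)^-1 * \sum_(T1 <= n < T) \sum_(u in UE) (2 * T%:R)).
  apply: mean_leD; first by exists A => //; exact: has_mean_cst.
  apply: mean_leZ; first by rewrite invr_ge0 exprn_ge0 ?ltW.
  apply: mean_le_sum => n _ _; apply: mean_le_sum => u _ uU.
  exact: deviation_mean.
apply: le_trans (le_has_mean he hb pathwise_regret) _.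
apply: (le_trans b2); rewrite lerD2l ler_pdivrMl ?exprn_gt0//.
(* At most [T] rounds and [T] arms, each with mean deviation at most [2 * T], give [2 * T ^ 3]; the
   factor [T ^ -3] leaves 2. *)
rewrite sumr_const sumr_const_nat -mulrnA -[leLHS]mulr_natr natrM.
have kT : (#|UE|%:R : R) <= T%:R by rewrite ler_nat; case/andP: UET.
have TT : ((T - T1)%:R : R) <= T%:R by rewrite ler_nat leq_subr.
have k0 : 0 <= (#|UE|%:R : R) by [].
have : #|UE|%:R * (T - T1)%:R <= (T%:R * T%:R : R) by exact: ler_pM.
move=> /(ler_wpM2l (ltW T0)); lra.
Qed.

(** Since [L >= 1 / 2], the root of [18 * L] is at most [10 * L], whence 60 = 6 * 10 with one power
    of the logarithm. The additive 2 is absorbed by [T1 >= 2]. *)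
Lemma regret_bound : (regret H Sx Cl Y eta unif T T1 delta rr tb P Sstar <=
  (60%:R * (Num.sqrt (#|UE|%:R * T%:R) * L ^+ 1 + T1%:R))%:E)%E.
Proof.
apply: (le_trans regret_le); rewrite lee_fin expr1.
have T12 : 2 <= (T1%:R : R).
  rewrite (ler_nat _ 2); case/andP: UET => k2 _; case/andP: UET1 => kT1 _.
  exact: leq_trans kT1.
have s0 := sqrtr_ge0 (#|UE|%:R * T%:R : R).
have sL : Num.sqrt (18 * L) <= 10 * L.
  have L0 : 0 <= 10 * L by have := Lhalf; lra.
  by rewrite -(ger0_norm L0) -sqrtr_sqr ler_sqrt ?sqr_ge0//; have := Lhalf; nra.
have := ler_wpM2r s0 sL; set s := Num.sqrt _ in s0 *; set r := Num.sqrt _.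
lra.
Qed.
End Regret.

Theorem theorem4 :
  exists C c : nat,
  forall (R : realType) (d : measure_display) (Omega : measurableType d)
    (P : probability Omega R) (K N : nat) (Us : finType) (H : 'M[bool]_N)
    (Sx : 'I_N -> superarm K N -> 'M[bool]_N -> Us)
    (Cl : {set {set 'I_N}})
    (Y : 'I_N -> superarm K N -> R)
    (eta : nat -> 'I_N -> Omega -> R) (unif : nat -> Omega -> R)
    (T T1 : nat) (rr : seq (expv N Us)) (tb : {set expv N Us} -> expv N Us)
    (Sstar : expv N Us),
  finset.partition Cl [set: 'I_N] ->
  (forall i A, 0 <= Y i A <= 1) ->
  noise_model P eta unif ->
  (2 <= #|UE H Sx Cl| <= T)%N ->
  (#|UE H Sx Cl| <= T1 <= T)%N ->
  perm_eq rr (enum (UE H Sx Cl)) ->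
  (forall X : {set expv N Us}, (0 < #|X|)%N -> tb X \in X) ->
  Sstar \in UE H Sx Cl ->
  (forall v, v \in UE H Sx Cl ->
     \sum_(i < N) Ytil H Sx Y i v <= \sum_(i < N) Ytil H Sx Y i Sstar) ->
  (regret H Sx Cl Y eta unif T T1 ((T%:R ^+ 2)^-1) rr tb P Sstar
   <= (C%:R * (Num.sqrt (#|UE H Sx Cl|%:R * T%:R) * (ln (T%:R : R)) ^+ c
               + T1%:R))%:E)%E.
Proof.
exists 60%N, 1%N => R d Omega P K N Us H Sx Cl Y eta unif T T1 rr tb Sstar _.
by move=> Y01 noise UET UET1 rrU tbP SsU Smax; exact: regret_bound.
Qed.
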